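(* Consider the minimization over $\mathbb{R}^d$ of $f=\frac1M\sum_{m=1}^M f_m$, where every $f_m$ is $\delta$-related to $f$ and $f$ is $\mu$-strongly convex, and let $x_*$ be its minimizer. Let $(y_k)_{k\ge 0}$, $(z_k)_{k\ge0}$ be generated by the algorithm EF-OLGA (described in the context) with a biased compressor $C$ with constant $\beta>1$ and parameters $p\in(0,1)$, $\theta>0$, $\tau\in(0,1)$, $\alpha>0$ such that $$\theta\le\frac{p^{3/2}}{24\delta}\le\frac1{6\delta},\qquad 28\alpha p\tau\le\theta .$$ Define $$Y_k=\frac{\alpha}{\tau}\,[f(y_k)-f(x_* )],\qquad Z_k=\frac{1+\mu\alpha}{2}\,\|z_k-x_*\|^2 .$$ Then for every $k\ge 0$ $$\mathbb{E}\left[Y_{k+1}+Z_{k+1}\right]\le \mathbb{E}\left[(1-\tau)Y_k+(1+\mu\alpha)^{-1}Z_k\right].$$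
   Context: Setting: $f_1,\dots,f_M:\mathbb{R}^d\to\mathbb{R}$ are twice differentiable (in the application $f_m(x)=\frac1{n_m}\sum_{j=1}^{n_m}\ell(x,z_j^m)$ is the local loss on node $m$), $f=\frac1M\sum_{m=1}^M f_m$, node $1$ is the server. The norm is Euclidean (spectral norm for matrices). $\delta$-relatedness: $\delta>0$ and $\|\nabla^2 f_m(x)-\nabla^2 f(x)\|\le\delta$ for all $x\in\mathbb{R}^d$ and all $m$. (The $f_m$ may be non-convex.) $\mu$-strong convexity: $\mu>0$ and $f(x)\ge f(y)+\langle\nabla f(y),x-y\rangle+\frac\mu2\|x-y\|^2$ for all $x,y\in\mathbb{R}^d$. Biased compressor with constant $\beta>1$: a (possibly random) map $C:\mathbb{R}^d\to\mathbb{R}^d$ with $\mathbb{E}_C[\|C(x)-x\|^2]\le\left(1-\frac1\beta\right)\|x\|^2$ for all $x\in\mathbb{R}^d$. Each application of $C$ uses fresh randomness, independent of the variables $N$ below. Epoch procedure $\mathrm{EFEpoch}(u_0,\theta,p)$: draw $N\sim\mathrm{Geom}(p)$, i.e. $\Pr[N=n]=p(1-p)^{n-1}$ for $n=1,2,\dots$, and put $\epsilon_0^m=0\in\mathbb{R}^d$ for all $m$. For $j=0,1,\dots,N-1$: for each $m$ put $\hat g_j^m=\nabla f_m(u_j)-\nabla f_1(u_j)-\nabla f_m(u_0)+\nabla f_1(u_0)$, $g_j^m=C(\epsilon_j^m+\theta\hat g_j^m)$, $\epsilon_{j+1}^m=\epsilon_j^m-g_j^m+\theta\hat g_j^m$;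 put $g_j=\frac1M\sum_{m=1}^M g_j^m$ and $s_j=\frac1\theta g_j-\nabla f_1(u_0)+\nabla f(u_0)$; set $u_{j+1}=\arg\min_{u\in\mathbb{R}^d}\left\{\langle s_j,u-u_j\rangle+\frac1{2\theta}\|u-u_j\|^2+f_1(u)\right\}$. Output the pair $\left(u_N,\ \frac1M\sum_{m=1}^M\epsilon_N^m\right)$. EF-OLGA: input $z_0=y_0\in\mathbb{R}^d$, $p\in(0,1)$, $\theta>0$, $\tau\in(0,1)$, $\alpha>0$. For $k=0,1,2,\dots$: $x_{k+1}=\tau z_k+(1-\tau)y_k$; $(y_{k+1},e_{k+1})=\mathrm{EFEpoch}(x_{k+1},\theta,p)$ (with fresh randomness); $t_k=\nabla(f_1-f)(x_{k+1})-\nabla(f_1-f)(y_{k+1})$; $\tilde y_{k+1}=y_{k+1}-e_{k+1}$ and $G_{k+1}=p\left(t_k+\frac{x_{k+1}-\tilde y_{k+1}}{\theta}\right)$; $z_{k+1}=\arg\min_{z\in\mathbb{R}^d}\left\{\frac1{2\alpha}\|z-z_k\|^2+\langle G_{k+1},z\rangle+\frac\mu2\|z-y_{k+1}\|^2\right\}$. $\mathbb{E}$ is expectation over all randomness. *)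

(* Defs.v *)
From HB Require Import structures.
From mathcomp Require Export all_boot all_order all_algebra.
From mathcomp Require Export all_classical all_reals all_analysis.
Export Order.TTheory GRing.Theory Num.Theory.
Export numFieldNormedType.Exports.

Set Implicit Arguments.
Unset Strict Implicit.
Unset Printing Implicit Defensive.

Local Open Scope classical_set_scope.
Local Open Scope ring_scope.

Section Euclidean.
Context {R : realType} {d : nat}.
Implicit Types (u v x : 'rV[R]_d) (h : 'rV[R]_d -> R).

(* The library's norm [`|x|] on ['rV[R]_d] is the sup norm, so the Euclidean
   structure is defined here; both norms induce the same topology, hence the
   same notion of (Frechet) differentiability. *)
Definition dotv u v : R := \sum_(i < d) u 0 i * v 0 i.
Definition enorm u : R := Num.sqrt (dotv u u).

(* Row vectors: [A] acts by [v |-> v *m A]. *)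
Definition specnorm (A : 'M[R]_d) : R :=
  sup [set enorm (v *m A) | v in [set v | enorm v <= 1]].

Definition grad h x : 'rV[R]_d := \row_(i < d) 'D_(delta_mx 0 i) h x.
Definition hess h x : 'M[R]_d := jacobian (grad h) x.

Definition twice_differentiable h : Prop :=
  (forall x, differentiable h x) /\ (forall x, differentiable (grad h) x).

Definition strongly_convex (mu : R) h : Prop :=
  forall x y,
    h y + dotv (grad h y) (x - y) + mu / 2 * enorm (x - y) ^+ 2 <= h x.

Definition is_minimizer h u : Prop := forall v, h u <= h v.

(* Some minimizer of [h]; the default value 0 is only used when there is none. *)
Definition argmin h : 'rV[R]_d := xget 0 [set u | is_minimizer h u].

End Euclidean.

Definition avg {R : realType} {V : lmodType R} {M : nat} (a : 'I_M -> V) : V :=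
  M%:R^-1 *: \sum_(m < M) a m.

Definition favg {R : realType} {d M : nat} (f : 'I_M -> 'rV[R]_d -> R)
  (x : 'rV[R]_d) : R := M%:R^-1 * \sum_(m < M) f m x.

Definition delta_related {R : realType} {d M : nat} (delta : R)
    (f : 'I_M -> 'rV[R]_d -> R) : Prop :=
  forall m x, specnorm (hess (f m) x - hess (favg f) x) <= delta.

(* ['rV[R]_d] with its Borel sigma-algebra. *)
Notation borelRV R d := (g_sigma_algebraType (@open 'rV[R]_d)).

(* A random map of R^d is a map [C s x] of a random seed [s] with law [Q] and a
   point [x]; joint measurability makes [C] applicable to random vectors. A
   deterministic map is one that ignores the seed. *)
Definition random_map {R : realType} {d : nat} {dS : measure_display}
    {S : measurableType dS} (C : S -> 'rV[R]_d -> 'rV[R]_d) : Prop :=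
  measurable_fun [set: S * borelRV R d]
    (fun sx : S * borelRV R d => C sx.1 sx.2 : borelRV R d).

Definition biased_compressor {R : realType} {d : nat} {dS : measure_display}
    {S : measurableType dS} (Q : probability S R) (beta : R)
    (C : S -> 'rV[R]_d -> 'rV[R]_d) : Prop :=
  random_map C /\
  forall x, ('E_Q[(fun s => enorm (C s x - x) ^+ 2)%R]
             <= ((1 - beta^-1) * enorm x ^+ 2)%:E)%E.

Section Algorithm.
Context {R : realType} {d M : nat} {S : Type}.
Variables (f : 'I_M -> 'rV[R]_d -> R) (server : 'I_M).
Variables (C : S -> 'rV[R]_d -> 'rV[R]_d) (p theta : R).
Local Notation vec := ('rV[R]_d).
Local Notation f1 := (f server).

(* One inner iteration: [st = (u_j, (eps_j^m)_m)], and [s m] is the seed with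
   which node [m] applies the compressor. *)
Definition ef_step (u0 : vec) (s : 'I_M -> S) (st : vec * ('I_M -> vec)) :
    vec * ('I_M -> vec) :=
  let u := st.1 in
  let eps := st.2 in
  let ghat m := grad (f m) u - grad f1 u - grad (f m) u0 + grad f1 u0 in
  let g m := C (s m) (eps m + theta *: ghat m) in
  let eps' m := eps m - g m + theta *: ghat m in
  let sj := theta^-1 *: avg g - grad f1 u0 + grad (favg f) u0 in
  (argmin (fun v => dotv sj (v - u) + (2 * theta)^-1 * enorm (v - u) ^+ 2
                    + f1 v),
   eps').

Fixpoint ef_iter (u0 : vec) (s : nat -> 'I_M -> S) (j : nat) :
    vec * ('I_M -> vec) :=
  if j is j'.+1 then ef_step u0 (s j') (ef_iter u0 s j')
  else (u0, fun=> 0).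

Definition EFEpoch (u0 : vec) (n : nat) (s : nat -> 'I_M -> S) : vec * vec :=
  let st := ef_iter u0 s n in (st.1, avg st.2).

Variables (mu tau alpha : R).

Definition olga_step (n : nat) (s : nat -> 'I_M -> S) (yz : vec * vec) :
    vec * vec :=
  let y := yz.1 in
  let z := yz.2 in
  let x' := tau *: z + (1 - tau) *: y in
  let: (y', e') := EFEpoch x' n s in
  let h v := f1 v - favg f v in
  let t := grad h x' - grad h y' in
  let ytilde := y' - e' in
  let G := p *: (t + theta^-1 *: (x' - ytilde)) in
  (y', argmin (fun v => (2 * alpha)^-1 * enorm (v - z) ^+ 2 + dotv G v
                        + mu / 2 * enorm (v - y') ^+ 2)).

(* [(y_k, z_k)] for a realization of the randomness: [n k] is the length of the
   epoch run at outer iteration [k], and [s k j m] the seed of the compressor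
   applied by node [m] at inner iteration [j] of that epoch. *)
Fixpoint ef_olga (y0 : vec) (n : nat -> nat) (s : nat -> nat -> 'I_M -> S)
    (k : nat) : vec * vec :=
  if k is k'.+1 then olga_step (n k') (s k') (ef_olga y0 n s k')
  else (y0, y0).

End Algorithm.

(* [F i] is the class of events of the [i]-th sigma-algebra. *)
Definition mutually_independent {dO : measure_display}
    {Omega : measurableType dO} {R : realType} (P : probability Omega R)
    {I : eqType} (F : I -> set (set Omega)) : Prop :=
  forall (s : seq I) (A : I -> set Omega), uniq s ->
    (forall i, i \in s -> F i (A i)) ->
    P (\bigcap_(i in [set` s]) A i) = (\prod_(i <- s) P (A i))%E.

(* Law of the randomness: the epoch lengths are geometric on {1, 2, ...}, the
   seeds have law [Q], and all these variables are mutually independent. *)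
Definition olga_randomness {dO dS : measure_display}
    {Omega : measurableType dO} {S : measurableType dS} {R : realType} {M : nat}
    (P : probability Omega R) (Q : probability S R) (p : R)
    (N : nat -> {RV P >-> nat}) (xi : nat -> nat -> 'I_M -> {RV P >-> S}) :
    Prop :=
  [/\ forall k n, P (N k @^-1` [set n.+1]) = (p * (1 - p) ^+ n)%:E,
      forall k j m B, measurable B -> distribution P (xi k j m) B = Q B
    & mutually_independent P
        (fun i : nat + nat * nat * 'I_M =>
           match i with
           | inl k => g_sigma_algebra_preimage (N k)
           | inr (k, j, m) => g_sigma_algebra_preimage (xi k j m)
           end)].

(* Main.v *)
From HB Require Import structures.
Require Import Defs.
From mathcomp Require Import all_boot all_order all_algebra.
From mathcomp Require Import all_classical all_reals all_analysis.
From mathcomp Require Import measurable_realfun ring lra.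
Import Order.TTheory GRing.Theory Num.Theory.
Import numFieldNormedType.Exports.
Local Open Scope classical_set_scope.
Local Open Scope ring_scope.

Set Implicit Arguments.
Unset Strict Implicit.
Unset Printing Implicit Defensive.

(** Fix an outer iteration with extrapolated point [x].  Along an epoch let
    [u_n] be the iterates, [e_n] the mean of the local errors, [g] the average
    loss, [h] the difference between the server loss and [g], and
    [v_n := u_n - e_n].  Error feedback makes the compression telescope: the
    optimality condition of the proximal subproblem reads
      [v_(n+1) = v_n - theta (grad g u_(n+1) + grad h u_(n+1) - grad h u_n)]
    ([epoch_recursion]), and [grad h] is [delta]-Lipschitz because the Hessian
    of [h] is bounded.  So an epoch is a proximal point method for [g] with two
    perturbations, the Lipschitz term and the errors.

    Three facts about a geometric length [N] then carry the proof.  They come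
    from summation by parts against the weights [p (1 - p)^n]
    ([geometric_sum_by_parts]).
    - The gradient surrogate [G] is unbiased for [grad g (u_N)], since
      [G - grad g] is a telescoping expression in [v_n / theta + grad h u_n].
    - [2 theta <grad g (u_N), x - u_N>] dominates [p |u_N - x|^2] in mean, up to
      a multiple of [|e_N|^2] ([epoch_energy]).
    - The error left by a compressor has at most the second moment of its input,
      so the errors satisfy a recursion with growth factor [1 + p/2], which the
      discount [1 - p] of the weights beats; this gives
      [E |e_N|^2 <= p/36 E |u_N - x|^2] ([weighted_error_bound]), and it is here
      that [theta] has to be of order [p^(3/2) / delta].
    The usual coupling of a mirror step with a gradient step ([mirror_step])
    turns these facts into the contraction; the condition on [alpha p tau]
    bounds the term [|G|^2] by [|u_N - x|^2].

    Integrability is settled without a priori bounds on the random length.  All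
    inequalities are proved for a fixed realization and for sums truncated at
    [K] ([outer_step_pathwise]).  The boundary term that summation by parts
    leaves is absorbed by the last summand up to a multiple of [(1 - p)^K], so
    only finiteness of each single second moment is used
    ([second_moments_finite]); then [K] tends to infinity
    ([expected_potential_le]).

    On the probabilistic side, each seed, and each epoch length, is independent
    of the sigma-algebra of the randomness used before it
    ([independent_history]), hence expectations can be computed by integrating
    that variable first ([expectation_independent]).  This needs the iterates to
    be random vectors, which holds because the proximal map is Lipschitz
    ([prox_lipschitz]). *)

(** * Euclidean geometry of row vectors *)

Section EuclideanGeometry.
Context {R : realType} {d : nat}.
Implicit Types (u v w x : 'rV[R]_d) (a t : R).

Lemma dotvC u v : dotv u v = dotv v u.
Proof. by apply: eq_bigr => i _; rewrite mulrC. Qed.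

Lemma dotvDl u v w : dotv (u + v) w = dotv u w + dotv v w.
Proof.
by rewrite /dotv -big_split /=; apply: eq_bigr => i _; rewrite mxE mulrDl.
Qed.

Lemma dotvDr u v w : dotv w (u + v) = dotv w u + dotv w v.
Proof. by rewrite dotvC dotvDl !(dotvC w). Qed.

Lemma dotvZl a u v : dotv (a *: u) v = a * dotv u v.
Proof.
by rewrite /dotv mulr_sumr; apply: eq_bigr => i _; rewrite mxE mulrA.
Qed.

Lemma dotvZr a u v : dotv u (a *: v) = a * dotv u v.
Proof. by rewrite dotvC dotvZl dotvC. Qed.

Lemma dotvNl u v : dotv (- u) v = - dotv u v.
Proof. by rewrite -scaleN1r dotvZl mulN1r. Qed.

Lemma dotvNr u v : dotv u (- v) = - dotv u v.
Proof. by rewrite dotvC dotvNl dotvC. Qed.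

Lemma dotv0l u : dotv 0 u = 0.
Proof. by rewrite -(scale0r 0) dotvZl mul0r. Qed.

Definition dotvE := (dotvDl, dotvDr, dotvNl, dotvNr, dotvZl, dotvZr).

Lemma dotv_suml I (r : seq I) (F : I -> 'rV[R]_d) v :
  dotv (\sum_(i <- r) F i) v = \sum_(i <- r) dotv (F i) v.
Proof.
by elim/big_ind2 : _ => [|x ? y ? <- <-|//]; rewrite ?dotv0l ?dotvDl.
Qed.

Lemma dotvv_ge0 u : 0 <= dotv u u.
Proof. by apply: sumr_ge0 => i _; rewrite -expr2 sqr_ge0. Qed.

Lemma dotvv_eq0 u : dotv u u = 0 -> u = 0.
Proof.
move=> /eqP; rewrite psumr_eq0 => [/allP h|i _]; last by rewrite -expr2 sqr_ge0.
apply/rowP => i; rewrite mxE; apply/eqP.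
by have := h i (mem_index_enum i); rewrite mulf_eq0 orbb.
Qed.

Lemma enorm_sqr u : enorm u ^+ 2 = dotv u u.
Proof. by rewrite sqr_sqrtr ?dotvv_ge0. Qed.

Lemma enorm_ge0 u : 0 <= enorm u. Proof. exact: sqrtr_ge0. Qed.

Lemma dotvvBC u v : dotv (u - v) (u - v) = dotv (v - u) (v - u).
Proof. by rewrite -(opprB u v) dotvNl dotvNr opprK. Qed.

Lemma dotvvD u v : dotv (u + v) (u + v) = dotv u u + 2 * dotv u v + dotv v v.
Proof. by rewrite !dotvE (dotvC v u); ring. Qed.

Lemma dotvvB u v : dotv (u - v) (u - v) = dotv u u - 2 * dotv u v + dotv v v.
Proof. by rewrite !dotvE (dotvC v u); ring. Qed.

Lemma dotvvZ a u : dotv (a *: u) (a *: u) = a ^+ 2 * dotv u u.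
Proof. by rewrite !dotvE; ring. Qed.

Lemma dotvvN u : dotv (- u) (- u) = dotv u u.
Proof. by rewrite dotvNl dotvNr opprK. Qed.

(** Young's inequality, with the weights the estimates below tune. *)
Lemma youngv t u v : 0 < t ->
  2 * dotv u v <= t * dotv u u + t^-1 * dotv v v.
Proof.
move=> t0; have := dotvv_ge0 (t *: u - v).
have -> : dotv (t *: u - v) (t *: u - v) =
    t * (t * dotv u u) - t * (2 * dotv u v) + dotv v v.
  by rewrite !dotvE (dotvC v u); ring.
move=> h; rewrite -(ler_pM2l t0) mulrDr mulVKf ?gt_eqF//; lra.
Qed.

Lemma youngvN t u v : 0 < t ->
  - (t * dotv u u + t^-1 * dotv v v) <= 2 * dotv u v.
Proof.
by move=> t0; have := youngv (- u) v t0; rewrite dotvvN dotvNl; lra.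
Qed.

Lemma sqnormD2 u v :
  dotv (u + v) (u + v) <= 2 * dotv u u + 2 * dotv v v.
Proof. by have := dotvv_ge0 (u - v); rewrite !dotvE (dotvC v u); lra. Qed.

Lemma sqnormB2 u v :
  dotv (u - v) (u - v) <= 2 * dotv u u + 2 * dotv v v.
Proof. by have := sqnormD2 u (- v); rewrite !dotvE opprK. Qed.

Lemma sqnormD3 u v w :
  dotv (u + v + w) (u + v + w) <= 3 * dotv u u + 3 * dotv v v + 3 * dotv w w.
Proof.
have := dotvv_ge0 (u - v); have := dotvv_ge0 (u - w).
have := dotvv_ge0 (v - w).
by rewrite !dotvE (dotvC v u) (dotvC w u) (dotvC w v); lra.
Qed.

Lemma cauchy_schwarz u v : dotv u v ^+ 2 <= dotv u u * dotv v v.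
Proof.
have [/dotvv_eq0 ->|u0] := eqVneq (dotv u u) 0.
  by rewrite !dotv0l expr0n mul0r.
have up : 0 < dotv u u by rewrite lt0r u0 dotvv_ge0.
have := dotvv_ge0 (dotv u u *: v - dotv u v *: u).
rewrite !dotvE (dotvC v u).
set a := dotv u u in up *; set b := dotv u v; set c := dotv v v => h.
rewrite -(ler_pM2l up).
suff : 0 <= a * (a * c - b ^+ 2) by rewrite mulrBr subr_ge0.
by apply: le_trans h _; rewrite le_eqVlt; apply/orP; left; apply/eqP; ring.
Qed.

Lemma dotv_le_enorm u v : dotv u v <= enorm u * enorm v.
Proof.
rewrite /enorm -sqrtrM ?dotvv_ge0//.
apply: le_trans (ler_norm _) _.
by rewrite -sqrtr_sqr ler_wsqrtr ?cauchy_schwarz.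
Qed.

Lemma enormZ a u : enorm (a *: u) = `|a| * enorm u.
Proof.
by rewrite /enorm !dotvE mulrA -expr2 sqrtrM ?sqr_ge0// sqrtr_sqr.
Qed.

(** A supremum in the reals is meaningful only for a bounded set; this makes
    the spectral norm a genuine operator norm. *)
Lemma enorm_mulmx_bounded (A : 'M[R]_d) :
  exists2 K : R, 0 <= K & forall v, enorm (v *m A) <= K * enorm v.
Proof.
exists (Num.sqrt (\sum_(j < d) dotv (\row_i A i j) (\row_i A i j))) => [|v].
  exact: sqrtr_ge0.
rewrite /enorm -sqrtrM; last by apply: sumr_ge0 => j _; exact: dotvv_ge0.
rewrite ler_wsqrtr// mulr_suml; apply: ler_sum => j _.
rewrite -expr2 mxE mulrC; apply: le_trans (cauchy_schwarz _ _).
rewrite le_eqVlt; apply/orP; left; apply/eqP; congr (_ ^+ 2).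
by apply: eq_bigr => i _; rewrite mxE.
Qed.

Lemma specnorm_bound (A : 'M[R]_d) v : enorm (v *m A) <= specnorm A * enorm v.
Proof.
have [K K0 AK] := enorm_mulmx_bounded A.
have [v0|v0] := eqVneq (enorm v) 0.
  by apply: le_trans (AK v) _; rewrite v0 !mulr0.
have vp : 0 < enorm v by rewrite lt0r v0 enorm_ge0.
have -> : v = enorm v *: ((enorm v)^-1 *: v) by rewrite scalerA divff ?scale1r.
rewrite -scalemxAl !enormZ normfV [`|enorm v|]ger0_norm ?enorm_ge0// mulVf// mulr1 mulrC.
rewrite ler_wpM2r ?enorm_ge0//.
apply: ub_le_sup.
  exists K => _ [w /= w1 <-]; apply: le_trans (AK w) _.
  by rewrite -[leRHS]mulr1 ler_wpM2l.
exists ((enorm v)^-1 *: v) => //=.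
by rewrite enormZ normfV [`|enorm v|]ger0_norm ?enorm_ge0// mulVf.
Qed.

(** Jensen: the variance of the family around its mean is nonnegative. *)
Lemma sqnorm_avg M (F : 'I_M -> 'rV[R]_d) : (0 < M)%N ->
  dotv (avg F) (avg F) <= avg (fun m => dotv (F m) (F m)).
Proof.
move=> M0; have Mp : 0 < M%:R :> R by rewrite ltr0n.
rewrite {3}/avg; have : \sum_(m < M) F m = M%:R *: avg F.
  by rewrite /avg scalerA divff ?scale1r// gt_eqF.
move: (avg F) => A FA.
have : 0 <= M%:R^-1 * \sum_(m < M) dotv (F m - A) (F m - A).
  apply: mulr_ge0; first by rewrite invr_ge0 ltW.
  by apply: sumr_ge0 => m _; exact: dotvv_ge0.
have -> : \sum_(m < M) dotv (F m - A) (F m - A) =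
    \sum_(m < M) dotv (F m) (F m) - 2 * dotv (\sum_(m < M) F m) A
    + M%:R * dotv A A.
  rewrite dotv_suml mulr_sumr -sumrB.
  have -> : M%:R * dotv A A = \sum_(m < M) dotv A A.
    by rewrite sumr_const card_ord mulr_natl.
  rewrite -big_split /=; apply: eq_bigr => m _.
  by rewrite !dotvE (dotvC A (F m)); ring.
rewrite FA dotvZl; set a := \sum_(m < M) _; set b := dotv A A.
have -> : M%:R^-1 * (a - 2 * (M%:R * b) + M%:R * b) =
   M%:R^-1 * a - (M%:R^-1 * M%:R) * b by ring.
by rewrite mulVf ?gt_eqF// mul1r subr_ge0.
Qed.

End EuclideanGeometry.

(** * Gradients along segments *)

Section Calculus.
Context {R : realType} {d : nat}.
Implicit Types (u v w x b : 'rV[R]_d) (h : 'rV[R]_d -> R).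

Lemma is_derive_line (W : normedModType R) (F : 'rV[R]_d -> W) b w (t : R) :
  differentiable F (b + t *: w) ->
  is_derive t 1 (fun s => F (b + s *: w)) ('D_w F (b + t *: w)).
Proof.
move=> /diff_derivable => /(_ w) Fd.
have e : (fun h : R => h^-1 *: ((F \o shift (b + t *: w)) (h *: w) - F (b + t *: w)))
    = (fun h : R => h^-1 *: (((fun s => F (b + s *: w)) \o shift t) (h *: (1 : R)) -
                         F (b + t *: w))).
  apply/funext => h /=; congr (_ *: (F _ - _)).
  by rewrite [h%:A]mulr1 scalerDl addrCA.
by apply: DeriveDef; [rewrite /derivable -e|rewrite /derive -e].
Qed.

Lemma is_derive_dotv (G : R -> 'rV[R]_d) v (t : R) (dG : 'rV[R]_d) :
  is_derive t 1 G dG -> is_derive t 1 (fun s => dotv (G s) v) (dotv dG v).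
Proof.
move=> [Gd <-].
have -> : (fun s => dotv (G s) v) = \sum_(i < d) (fun s => v 0 i * G s 0 i).
  by apply/funext => s; rewrite fct_sumE; apply: eq_bigr => i _; rewrite mulrC.
apply: is_derive_eq.
  apply: is_derive_sum => i.
  apply: (@is_deriveZ _ _ _ (fun s => G s 0 i) (v 0 i) t 1 ('D_1 G t 0 i)).
  have Gi := (derivable_mxP _ _ _).1 Gd 0 i.
  by rewrite derive_mx// mxE; exact: DeriveDef.
by apply: eq_bigr => i _; rewrite mulrC.
Qed.

Lemma derive_dotv_grad h x w :
  differentiable h x -> 'D_w h x = dotv (grad h x) w.
Proof.
move=> hx; rewrite deriveE// {1}[w]row_sum_delta linear_sum /=.
by apply: eq_bigr => i _; rewrite linearZ /= mxE deriveE// mulrC.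
Qed.

Lemma is_derive_line_grad h b w (t : R) : differentiable h (b + t *: w) ->
  is_derive t 1 (fun s => h (b + s *: w)) (dotv (grad h (b + t *: w)) w).
Proof. by move=> hd; rewrite -derive_dotv_grad//; exact: is_derive_line. Qed.

Lemma mean_value_line h b w : (forall x, differentiable h x) ->
  exists2 c : R, 0 <= c <= 1 & h (b + w) - h b = dotv (grad h (b + c *: w)) w.
Proof.
move=> hd; pose phi (s : R) := h (b + s *: w).
have phid (s : R) : is_derive s 1 phi (dotv (grad h (b + s *: w)) w).
  exact: is_derive_line_grad.
have [|c] := @MVT_segment R phi _ 0 1 ler01 (fun s _ => phid s).
  apply: derivable_within_continuous => s _.
  by have [] := phid s.
by rewrite in_itv /= => c01; rewrite /phi scale1r scale0r addr0 subr0 mulr1; exists c.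
Qed.

(** Testing [F a - F b] against itself reduces to a scalar function on the
    segment, to which the mean value theorem applies. *)
Lemma lipschitz_of_derive (F : 'rV[R]_d -> 'rV[R]_d) (L : R) : 0 <= L ->
  (forall x, differentiable F x) ->
  (forall x w, enorm ('D_w F x) <= L * enorm w) ->
  forall a b, dotv (F a - F b) (F a - F b) <= L ^+ 2 * dotv (a - b) (a - b).
Proof.
move=> L0 Fd FL a b; set v := F a - F b; set w := a - b.
pose phi (s : R) := dotv (F (b + s *: w)) v.
have phid (s : R) : is_derive s 1 phi (dotv ('D_w F (b + s *: w)) v).
  by apply: is_derive_dotv; exact: is_derive_line.
have [|c _] := @MVT_segment R phi _ 0 1 ler01 (fun s _ => phid s).
  by apply: derivable_within_continuous => s _; have [] := phid s.
rewrite /phi scale1r scale0r addr0 subr0 mulr1 /w subrKC -/w.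
rewrite -dotvNl -dotvDl -/v => e.
have : enorm v * enorm v <= L * enorm w * enorm v.
  rewrite -expr2 enorm_sqr e; apply: le_trans (dotv_le_enorm _ _) _.
  by rewrite ler_wpM2r ?enorm_ge0.
rewrite -!enorm_sqr -exprMn => h.
have [v0|v0] := eqVneq (enorm v) 0.
  by rewrite v0 expr0n /= sqr_ge0.
rewrite ler_pXn2r ?nnegrE ?mulr_ge0 ?enorm_ge0//.
by rewrite ler_pM2r in h; rewrite ?lt0r ?v0 ?enorm_ge0.
Qed.

(** Only one-dimensional calculus is used: the restriction of the objective to
    the line through [u] in the direction [w] of the gradient has a minimum at
    [0], and its derivative there is [dotv w w].  With [a = 0] this is Fermat's
    rule. *)
Lemma first_order_condition h (a : R) b u : (forall x, differentiable h x) ->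
  is_minimizer (fun v => a * dotv (v - b) (v - b) + h v) u ->
  grad h u = - (2 * a) *: (u - b).
Proof.
move=> hd umin; set w := grad h u + (2 * a) *: (u - b).
suff w0 : dotv w w = 0.
  by apply/eqP; rewrite scaleNr -addr_eq0; apply/eqP/dotvv_eq0.
pose phi (s : R) := h (u + s *: w)
  + (s * (2 * a * dotv (u - b) w) + s ^+ 2 * (a * dotv w w)).
have phid (s : R) : is_derive s 1 phi (dotv (grad h (u + s *: w)) w
   + (2 * a * dotv (u - b) w + 2 * s * (a * dotv w w))).
  have hdl := is_derive_line_grad (hd (u + s *: w)).
  have qd (A B : R) : is_derive s 1 (A *: id + B *: (id ^+ 2) : R -> R)
      (A + 2 * s * B).
    apply: is_derive_eq; rewrite expr1 /GRing.scale /=; ring.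
  have -> : phi = (fun s => h (u + s *: w)) +
    ((2 * a * dotv (u - b) w) *: id + (a * dotv w w) *: (id ^+ 2) : R -> R).
    apply/funext => r; rewrite /phi /= [in RHS]fctE; congr (_ + _).
    rewrite [RHS](_ : _ = 2 * a * dotv (u - b) w * r
      + a * dotv w w * (r * r)) //; ring.
  exact: is_deriveD.
have : is_derive (0:R) 1 phi 0.
  apply: (@derive1_at_min R phi (-1) 1 0).
  - by lra.
  - by move=> t _; have [] := phid t.
  - by rewrite in_itv /=; lra.
  - move=> t _; have := umin (u + t *: w).
    rewrite /phi /= scale0r addr0 (addrAC u) (dotvvD (u - b)) dotvvZ dotvZr; lra.
have := phid 0.
move=> [_ e0] [_ e1]; move: e0; rewrite e1 scale0r addr0.
rewrite mulr0 mul0r addr0 => e0.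
by rewrite {1}/w dotvDl dotvZl -/w -e0.
Qed.

Lemma differentiable_sqnorm b v : differentiable (fun v => dotv (v - b) (v - b)) v.
Proof.
have -> : (fun v => dotv (v - b) (v - b)) =
    \sum_(i < d) (fun v => v 0 i - b 0 i) ^+ 2.
  by apply/funext => u; rewrite fct_sumE; apply: eq_bigr => i _; rewrite !mxE.
apply: differentiable_sum => i; apply: differentiableX; apply: differentiableB.
  exact: differentiable_coord.
exact: differentiable_cst.
Qed.

Lemma continuous_sqnorm b : continuous (fun v => dotv (v - b) (v - b)).
Proof.
by move=> v; apply: differentiable_continuous; exact: differentiable_sqnorm.
Qed.

(** Links the Euclidean norm to the ambient sup norm, in which continuity and
    boundedness are expressed. *)
Lemma normr_lt_sqnorm v (e : R) : 0 < e -> dotv v v < e ^+ 2 -> `|v| < e.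
Proof.
move=> e0 ve; rewrite [ltLHS]/Num.norm /= mx_normrE.
apply/bigmax_ltP; split => // -[i j] _ /=; rewrite (ord1 i).
have vj : v 0 j ^+ 2 <= dotv v v.
  rewrite /dotv (bigD1 j)//= expr2 lerDl.
  by apply: sumr_ge0 => k _; rewrite -expr2 sqr_ge0.
rewrite -(ltr_pXn2r (_ : (0 < 2)%N)) ?nnegrE ?normr_ge0 ?(ltW e0)//.
by rewrite real_normK ?num_real//; exact: le_lt_trans ve.
Qed.

Lemma normr_le_sqnorm v : `|v| <= dotv v v + 1.
Proof.
by apply/ltW/normr_lt_sqnorm; have := dotvv_ge0 v; nra.
Qed.

(** A continuous function that is no smaller than at [b] outside a ball around
    [b] attains its minimum in that ball, by compactness. *)
Lemma minimizer_exists (psi : 'rV[R]_d -> R) b (K : R) : continuous psi ->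
  (forall v, K < dotv (v - b) (v - b) -> psi b <= psi v) ->
  exists u, is_minimizer psi u.
Proof.
move=> psic out; pose A := [set v | dotv (v - b) (v - b) <= Num.max K 0].
have Ab : A b by rewrite /A /= subrr dotv0l le_max lexx orbT.
have cA : compact A.
  apply: bounded_closed_compact.
    exists (Num.max K 0 + 1 + `|b|); split; first by rewrite num_real.
    move=> r rK v /= Av; apply: (le_trans _ (ltW rK)).
    rewrite -[in leLHS](subrK b v); apply: le_trans (ler_normD _ _) _.
    rewrite lerD2r; apply: le_trans (normr_le_sqnorm _) _.
    by rewrite lerD2r.
  have -> : A = (fun v => dotv (v - b) (v - b)) @^-1` [set r | r <= Num.max K 0].
    by [].
  by apply: closed_comp => [v _|]; [exact: continuous_sqnorm|exact: closed_le].
have [|c cA1 cmin] := @EVT_min_rV R d psi A (ex_intro _ b Ab) cA.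
  exact: continuous_subspaceT.
exists c => v; have [Av|nAv] := pselect (A v).
  by apply: cmin; rewrite inE.
apply: le_trans (cmin b _) (out v _); first by rewrite inE.
move/negP : nAv; rewrite /A /= -ltNge; apply: le_lt_trans.
by rewrite le_max lexx.
Qed.

End Calculus.

(** * The objective functions *)

Section Objectives.
Context {R : realType} {d : nat}.
Implicit Types (u v w x b : 'rV[R]_d) (g h : 'rV[R]_d -> R).

Lemma gradB g h x : differentiable g x -> differentiable h x ->
  grad (fun v => g v - h v) x = grad g x - grad h x.
Proof.
move=> gd hd; apply/rowP => i; rewrite !mxE.
by rewrite deriveB//; exact: diff_derivable.
Qed.

Lemma favgE M (f : 'I_M -> 'rV[R]_d -> R) : favg f = M%:R^-1 *: \sum_(m < M) f m.
Proof.
by apply/funext => x; rewrite /favg [in RHS]fctE fct_sumE.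
Qed.

Lemma differentiable_favg M (f : 'I_M -> 'rV[R]_d -> R) x :
  (forall m, differentiable (f m) x) -> differentiable (favg f) x.
Proof.
by move=> fd; rewrite favgE; apply: differentiableZ; exact: differentiable_sum.
Qed.

Lemma grad_favg M (f : 'I_M -> 'rV[R]_d -> R) x :
  (forall m, differentiable (f m) x) ->
  grad (favg f) x = avg (fun m => grad (f m) x).
Proof.
move=> fd; apply/rowP => i; rewrite mxE favgE.
have fi m : derivable (f m) x (delta_mx 0 i) by exact: diff_derivable.
rewrite deriveZ; last exact: derivable_sum.
rewrite derive_sum// /avg mxE summxE; congr (_ * _).
by apply: eq_bigr => m _; rewrite mxE.
Qed.

Lemma differentiable_grad_favg M (f : 'I_M -> 'rV[R]_d -> R) x :
  (forall m, twice_differentiable (f m)) -> differentiable (grad (favg f)) x.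
Proof.
move=> f2; have -> : grad (favg f) = M%:R^-1 *: \sum_(k < M) grad (f k).
  apply/funext => y; rewrite grad_favg; last by move=> m; have [] := f2 m.
  by rewrite /avg [in RHS]fctE fct_sumE.
apply: differentiableZ; apply: differentiable_sum => m.
by have [] := f2 m.
Qed.

(** The Hessian bound enters the analysis through this Lipschitz estimate. *)
Lemma grad_difference_lipschitz M (f : 'I_M -> 'rV[R]_d -> R) (delta : R) :
  (forall m, twice_differentiable (f m)) -> 0 <= delta -> delta_related delta f ->
  forall m a b,
  dotv ((grad (f m) a - grad (favg f) a) - (grad (f m) b - grad (favg f) b))
       ((grad (f m) a - grad (favg f) a) - (grad (f m) b - grad (favg f) b))
  <= delta ^+ 2 * dotv (a - b) (a - b).
Proof.
move=> f2 delta0 fdelta m.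
have fd k x : differentiable (f k) x by have [] := f2 k.
have gd k x : differentiable (grad (f k)) x by have [] := f2 k.
have ad x : differentiable (grad (favg f)) x by exact: differentiable_grad_favg.
apply: (@lipschitz_of_derive _ _ (fun x => grad (f m) x - grad (favg f) x)).
- exact: delta0.
- by move=> x; exact: differentiableB.
move=> x w.
rewrite deriveB; [|exact: diff_derivable|exact: diff_derivable].
rewrite !deriveEjacobian// -mulmxBr.
apply: le_trans (specnorm_bound _ _) _.
by rewrite ler_wpM2r ?enorm_ge0//; exact: fdelta.
Qed.

Lemma strongly_convex_monotone mu g u v : strongly_convex mu g ->
  mu * dotv (u - v) (u - v) <= dotv (grad g u - grad g v) (u - v).
Proof.
move=> gmu; have := gmu u v; have := gmu v u.
rewrite !enorm_sqr (dotvvBC v u) -(opprB u v) !dotvE !mulrDr !mulrN; lra.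
Qed.

Lemma strongly_convex_growth mu g u y : (forall x, differentiable g x) ->
  strongly_convex mu g -> is_minimizer g u ->
  mu / 2 * dotv (y - u) (y - u) <= g y - g u.
Proof.
move=> gd gmu gu; have := gmu y u.
have -> : grad g u = - (2 * 0) *: (u - 0).
  apply: (first_order_condition gd) => v; rewrite !mul0r !add0r; exact: gu.
by rewrite mulr0 oppr0 scale0r dotv0l enorm_sqr; lra.
Qed.

Lemma argminP h : (exists u, is_minimizer h u) -> is_minimizer h (argmin h).
Proof.
move=> [u hu].
exact: (@xgetPex _ 0 [set v | is_minimizer h v] (ex_intro _ u hu)).
Qed.

Lemma argmin_unique h u : is_minimizer h u ->
  (forall v, is_minimizer h v -> v = u) -> argmin h = u.
Proof. by move=> hu h1; exact: h1 (argminP (ex_intro _ u hu)). Qed.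

(** Not a mere equality of minimizer sets: the choice made by [argmin] depends
    on that set only, so the chosen points agree. *)
Lemma argmin_shift g h (c : R) : (forall v, g v = h v + c) ->
  argmin g = argmin h.
Proof.
move=> gh; rewrite /argmin; congr (xget _ _); apply/seteqP; split => u /= gu v.
  by have := gu v; rewrite !gh lerD2r.
by rewrite !gh lerD2r.
Qed.

(** Completing the square around the point on the right. *)
Lemma argmin_quadratic (a mu : R) (G z y : 'rV[R]_d) : 0 < a -> 0 < mu ->
  argmin (fun v => (2 * a)^-1 * enorm (v - z) ^+ 2 + dotv G v
                   + mu / 2 * enorm (v - y) ^+ 2) =
  (a^-1 + mu)^-1 *: (a^-1 *: z + mu *: y - G).
Proof.
move=> a0 mu0; set k := a^-1 + mu; set h := (fun v => _).
set u := k^-1 *: _.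
have k0 : 0 < k by rewrite addr_gt0 ?invr_gt0.
have hE v : h v = h u + k / 2 * dotv (v - u) (v - u).
  have [w ->] : exists w, v = u + w by exists (v - u); rewrite addrC subrK.
  rewrite /h !enorm_sqr (addrC u w) addrK -!addrA (dotvC G).
  have ku : k *: u = a^-1 *: z + mu *: y - G.
    by rewrite /u scalerA divff ?scale1r ?gt_eqF.
  have {ku} : dotv (k *: u) w = dotv (a^-1 *: z + mu *: y - G) w by rewrite ku.
  rewrite (_ : (2 * a)^-1 = a^-1 / 2); last by rewrite invfM mulrC.
  rewrite /k; move: (a^-1) u => b {}u.
  rewrite !dotvE (dotvC u w) (dotvC z w) (dotvC y w) (dotvC G w) (dotvC G u).
  rewrite (dotvC z u) (dotvC y u); lra.
apply: argmin_unique => [v|v hv].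
  rewrite (hE v) lerDl mulr_ge0 ?dotvv_ge0// divr_ge0 ?ltW//.
have := hv u; rewrite (hE v) gerDl pmulr_rle0 ?divr_gt0// => vu.
apply/eqP; rewrite -subr_eq0; apply/eqP/dotvv_eq0.
by apply: le_anti; rewrite vu dotvv_ge0.
Qed.

End Objectives.

(** * The proximal map *)

Section Prox.
Context {R : realType} {d : nat}.
Variables (f1 g : 'rV[R]_d -> R) (delta mu theta : R) (xstar : 'rV[R]_d).
Implicit Types (u v w x b : 'rV[R]_d).
Hypothesis f1d : forall x, differentiable f1 x.
Hypothesis gd : forall x, differentiable g x.
Hypothesis delta0 : 0 < delta.
Let H x := grad f1 x - grad g x.
Hypothesis Hlip : forall a b,
  dotv (H a - H b) (H a - H b) <= delta ^+ 2 * dotv (a - b) (a - b).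
Hypothesis mu0 : 0 < mu.
Hypothesis gmu : strongly_convex mu g.
Hypothesis gmin : is_minimizer g xstar.
Hypothesis theta0 : 0 < theta.
Hypothesis theta_small : theta * delta <= 24^-1.

Definition prox b :=
  argmin (fun v => (2 * theta)^-1 * dotv (v - b) (v - b) + f1 v).

Lemma dotv_lipschitz_le a b w :
  - (delta / 2 * (dotv (a - b) (a - b) + dotv w w)) <= dotv (H a - H b) w.
Proof.
have di : 0 < delta^-1 by rewrite invr_gt0.
have := youngvN (H a - H b) w di; rewrite invrK.
have : delta^-1 * dotv (H a - H b) (H a - H b) <= delta * dotv (a - b) (a - b).
  by rewrite ler_pdivrMl// mulrA -expr2.
lra.
Qed.

(** [f1] may be nonconvex, but it is [g], which is bounded below, plus a
    function with [delta]-Lipschitz gradient; the latter decreases at most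
    quadratically, at a rate that [1 / (2 theta)] exceeds. *)
Lemma prox_minimizer b :
  is_minimizer (fun v => (2 * theta)^-1 * dotv (v - b) (v - b) + f1 v) (prox b).
Proof.
apply: argminP.
have t0 : 0 < theta^-1 by rewrite invr_gt0.
(* Beyond the squared radius [2 * K] the quadratic growth outweighs the gap of
   [g] at [b] and the linear part [H b] of the perturbation. *)
pose K := 2 * theta * ((2 * delta)^-1 * dotv (H b) (H b) + (g b - g xstar)) .
apply: (@minimizer_exists _ _ _ b (2 * K)) => [v|v Kv].
  apply: differentiable_continuous; apply: differentiableD => //.
  apply: (@differentiableZ _ _ _ (fun v => dotv (v - b) (v - b))).
  exact: differentiable_sqnorm.
rewrite subrr dotv0l mulr0 add0r.
have hd x : differentiable (f1 \- g) x by exact: differentiableB.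
have [c /andP[c0 c1]] := mean_value_line b (v - b) hd.
rewrite [b + (v - b)]addrC subrK /= (gradB (f1d _) (gd _)) => e.
have := dotv_lipschitz_le (b + c *: (v - b)) b (v - b).
have gv := gmin v; have gb := gmin b.
have di : 0 < delta^-1 by rewrite invr_gt0.
have := youngvN (H b) (v - b) di; rewrite invrK.
move: e; rewrite -/(H _) (addrAC b) subrr add0r dotvvZ; set w := v - b in Kv *.
have -> : dotv (H (b + c *: w) - H b) w = dotv (H (b + c *: w)) w - dotv (H b) w.
  by rewrite dotvDl dotvNl.
set X := dotv (H (b + _)) w; set Y := dotv (H b) w; set r := dotv w w in Kv *.
have r0 : 0 <= r := dotvv_ge0 w.
have cr : c ^+ 2 * r <= r.
  by rewrite ler_piMl// expr_le1.
move=> e y1 y2.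
have d1 : delta * r <= 24^-1 * (theta^-1 * r).
  by rewrite mulrA ler_wpM2r// ler_pdivlMr// mulrC.
rewrite invfM.
have k1 : theta^-1 * K = delta^-1 * dotv (H b) (H b) + 2 * (g b - g xstar).
  rewrite /K invfM; field; rewrite ?gt_eqF//.
have k2 : 2 * (theta^-1 * K) < theta^-1 * r by rewrite mulrCA ltr_pM2l.
have dcr : delta * (c ^+ 2 * r) <= delta * r by rewrite ler_pM2l.
have : 0 <= delta^-1 * dotv (H b) (H b) by rewrite mulr_ge0 ?dotvv_ge0 ?invr_ge0 ?ltW.
have {}y2 : - (2^-1 * (delta * (c ^+ 2 * r) + delta * r)) <= X - Y.
  by move: y2; rewrite -mulrDr [2^-1 * _]mulrCA mulrA.
rewrite -mulrA; clear Kv cr; move: e y1 y2 d1 k1 k2 dcr gv gb.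
move: (theta^-1 * K) (delta^-1 * dotv (H b) (H b)) (theta^-1 * r) => A B T.
move: (delta * (c ^+ 2 * r)) (delta * r) X Y => s t X Y *; lra.
Qed.

Lemma proxE b : prox b = b - theta *: grad f1 (prox b).
Proof.
have := first_order_condition f1d (prox_minimizer b).
move=> ->; rewrite invfM mulrA divff ?mul1r ?pnatr_eq0//.
by rewrite scaleNr scalerN opprK scalerA divff ?gt_eqF// scale1r addrC subrK.
Qed.

(** [grad g] is monotone and [theta H] is a small Lipschitz perturbation, so the
    inverse of the identity plus [theta grad f1] is Lipschitz.  Continuity of
    the proximal map is what makes the iterates measurable. *)
Lemma prox_lipschitz b c :
  dotv (prox b - prox c) (prox b - prox c) <= 4 * dotv (b - c) (b - c).
Proof.
have := strongly_convex_monotone (prox b) (prox c) gmu.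
have := dotv_lipschitz_le (prox b) (prox c) (prox b - prox c).
have Ep x : x = prox x + theta *: (H (prox x) + grad g (prox x)).
  by rewrite /H subrK {1}[prox x]proxE subrK.
have E : b - c = (prox b - prox c)
   + theta *: ((H (prox b) - H (prox c)) + (grad g (prox b) - grad g (prox c))).
  rewrite {1}(Ep b) {1}(Ep c); move: (prox b) (prox c) => u v.
  move: (H u) (H v) (grad g u) (grad g v) => x y z w.
  by rewrite !scalerDr !scalerN !opprD !addrA; apply/rowP => i; rewrite !mxE; ring.
rewrite {}E; move: (H (prox b) - H (prox c)) (grad g (prox b) - _) => X Y.
move: (prox b - prox c) => D.
have := dotvv_ge0 D; have := dotvv_ge0 (X + Y).
rewrite (dotvvD D) dotvvZ dotvZr (dotvDr X Y D) (dotvC D X) (dotvC D Y).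
set r := dotv D D; set q := dotv _ _ => q0 r0 Xr Yr.
have tX : - (24^-1 * r) <= theta * dotv X D.
  have : theta * - (delta / 2 * (r + r)) <= theta * dotv X D by rewrite ler_pM2l.
  have : theta * delta * r <= 24^-1 * r by rewrite ler_wpM2r.
  lra.
have tY : 0 <= theta * dotv Y D.
  exact: mulr_ge0 (ltW theta0) (le_trans (mulr_ge0 (ltW mu0) r0) Yr).
have : 0 <= theta ^+ 2 * q by rewrite mulr_ge0 ?sqr_ge0.
lra.
Qed.

Lemma continuous_prox : continuous prox.
Proof.
move=> b; apply/(@cvgrPdist_lt _ _ _ _ (nbhs_filter b)) => e e0.
have := @continuous_sqnorm _ _ b b; rewrite /continuous_at subrr dotv0l.
move=> /(@cvgrPdist_lt _ _ _ _ (nbhs_filter b)) /(_ (e ^+ 2 / 4)).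
rewrite divr_gt0 ?exprn_gt0// => /(_ isT).
apply: filterS => c; rewrite sub0r normrN ger0_norm ?dotvv_ge0// => cb.
apply: normr_lt_sqnorm => //; apply: le_lt_trans (prox_lipschitz _ _) _.
by rewrite dotvvBC; lra.
Qed.

Lemma argmin_proximal_step s u :
  argmin (fun v => dotv s (v - u) + (2 * theta)^-1 * enorm (v - u) ^+ 2 + f1 v) =
  prox (u - theta *: s).
Proof.
apply: (@argmin_shift _ _ _ _ (- (theta / 2 * dotv s s))) => v.
rewrite enorm_sqr (_ : v - (u - theta *: s) = (v - u) + theta *: s); last first.
  by rewrite opprB addrA addrAC.
rewrite !(dotvDl (v - u)) !(dotvDr (v - u)) !dotvZl !dotvZr (dotvC _ s).
by field; rewrite gt_eqF.
Qed.

End Prox.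

(** * Geometrically weighted sums *)

Section GeometricSums.
Context {R : realType}.
Implicit Types (p : R) (D E : nat -> R) (K : nat).

(** In mean over a geometric length, the increment [D N - D (N - 1)] equals
    [p (D N - D 0)]; the term in [D K] is the price of truncation. *)
Lemma geometric_sum_by_parts p D K :
  \sum_(n < K) p * (1 - p) ^+ n * (D n.+1 - D n) =
  p * (\sum_(n < K) p * (1 - p) ^+ n * D n.+1) + p * (1 - p) ^+ K * D K - p * D 0%N.
Proof.
elim: K => [|K IH]; first by rewrite !big_ord0 expr0; ring.
by rewrite !big_ord_recr /= IH exprS; ring.
Qed.

Lemma geometric_weights_sum p K :
  \sum_(n < K) p * (1 - p) ^+ n = 1 - (1 - p) ^+ K.
Proof.
elim: K => [|K IH]; first by rewrite big_ord0 expr0 subrr.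
by rewrite big_ord_recr /= IH exprS; ring.
Qed.

Lemma geometric_weight_ge0 p n : 0 < p < 1 -> 0 <= p * (1 - p) ^+ n.
Proof.
move=> /andP[p0 p1]; apply: mulr_ge0; first exact: ltW.
by apply: exprn_ge0; lra.
Qed.

Lemma geometric_sum_shift p E K : 0 < p < 1 -> E 0%N = 0 ->
  (forall n, 0 <= E n) ->
  \sum_(n < K) p * (1 - p) ^+ n * E n <=
  (1 - p) * \sum_(n < K) p * (1 - p) ^+ n * E n.+1.
Proof.
move=> p01 E0 Ege0; case: K => [|K]; first by rewrite !big_ord0 mulr0.
rewrite big_ord_recl E0 mulr0 add0r big_ord_recr /= mulrDr mulr_sumr.
rewrite -[leLHS]addr0; apply: lerD.
  rewrite le_eqVlt; apply/orP; left; apply/eqP; apply: eq_bigr => n _.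
  by rewrite /bump /= exprS; ring.
apply: mulr_ge0; first by case/andP: p01; lra.
by apply: mulr_ge0 => //; exact: geometric_weight_ge0.
Qed.

(** [1 - (1 - p) (1 + p / 2) = p (1 + p) / 2] stays positive: the discount of
    the weights exceeds the growth of the recursion, which sums up. *)
Lemma weighted_error_bound p (a s : nat -> R) K : 0 < p < 1 ->
  a 0%N = 0 -> s 0%N = 0 -> (forall n, 0 <= a n) -> (forall n, 0 <= s n) ->
  (forall n, s n.+1 <= (1 + p / 2) * s n + p ^+ 2 * (p + 2) / 144 * a n) ->
  \sum_(n < K) p * (1 - p) ^+ n * s n.+1 <=
  p / 36 * \sum_(n < K) p * (1 - p) ^+ n * a n.+1.
Proof.
move=> p01 a0 s0 age0 sge0 rec; have /andP[p0 p1] := p01.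
have w0 n := geometric_weight_ge0 n p01.
have sa := geometric_sum_shift K p01 a0 age0.
have ss := geometric_sum_shift K p01 s0 sge0.
have : \sum_(n < K) p * (1 - p) ^+ n * s n.+1 <=
    (1 + p / 2) * (\sum_(n < K) p * (1 - p) ^+ n * s n)
    + p ^+ 2 * (p + 2) / 144 * (\sum_(n < K) p * (1 - p) ^+ n * a n).
  rewrite !mulr_sumr -big_split /=; apply: ler_sum => n _.
  rewrite (mulrCA (1 + _)) (mulrCA (_ / 144)) -mulrDr.
  exact: ler_wpM2l (w0 n) _ _ (rec n).
have a1 : 0 <= \sum_(n < K) p * (1 - p) ^+ n * a n.+1.
  by apply: sumr_ge0 => n _; exact: mulr_ge0.
move: sa ss a1.
move: (\sum_(n < K) _ * s n.+1) (\sum_(n < K) _ * a n.+1).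
move: (\sum_(n < K) _ * s n) (\sum_(n < K) _ * a n) => s1 a1 S A a1A s1S A0 h.
have c0 : 0 <= p ^+ 2 * (p + 2) / 144.
  by rewrite divr_ge0// mulr_ge0 ?sqr_ge0//; lra.
have h1 : p / 2 * ((1 + p) * S) <= p ^+ 2 * (p + 2) / 144 * ((1 - p) * A).
  have := ler_wpM2l c0 a1A; have : 0 <= 1 + p / 2 by lra.
  by move=> /ler_wpM2l /(_ _ _ s1S); lra.
have p1' : 0 < 1 + p by lra.
have p2 : 0 < p / 2 by lra.
rewrite -(ler_pM2l p1') -(ler_pM2l p2); apply: le_trans h1 _.
rewrite -subr_ge0.
have -> : p / 2 * ((1 + p) * (p / 36 * A)) - p ^+ 2 * (p + 2) / 144 * ((1 - p) * A)
  = (p ^+ 2 * (p * (3 + p)) / 144) * A by field.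
by rewrite mulr_ge0// divr_ge0// !mulr_ge0 ?sqr_ge0 ?(ltW p0)//; lra.
Qed.

Lemma le_of_le_geometric (q r a c : R) k : 0 <= q < 1 ->
  (forall l, (k <= l)%N -> r <= a + c * q ^+ l) -> r <= a.
Proof.
move=> /andP[q0 q1] h.
have cv : (a + c * q ^+ l) @[l --> \oo] --> a + c * 0.
  apply: cvgD; first exact: cvg_cst.
  apply: cvgMr; apply: cvg_expr; by rewrite ger0_norm.
rewrite mulr0 addr0 in cv.
apply: (cvgr_to_ge cv); near=> l; apply: h; near: l; exact: nbhs_infty_ge.
Unshelve. all: by end_near. Qed.

End GeometricSums.

(** * One outer iteration along a realization *)

Section Pathwise.
Context {R : realType} {d : nat}.
Variables (g : 'rV[R]_d -> R) (H : 'rV[R]_d -> 'rV[R]_d).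
Variables (delta mu theta p : R) (xstar : 'rV[R]_d).
Implicit Types (u v w x y z e b : 'rV[R]_d).
Hypothesis delta0 : 0 < delta.
Hypothesis Hlip : forall a b,
  dotv (H a - H b) (H a - H b) <= delta ^+ 2 * dotv (a - b) (a - b).
Hypothesis mu0 : 0 < mu.
Hypothesis gmu : strongly_convex mu g.
Hypothesis gmin : is_minimizer g xstar.
Hypothesis p01 : 0 < p < 1.
Hypothesis theta0 : 0 < theta.
Hypothesis theta_small : (theta * delta) ^+ 2 <= p ^+ 3 / 576.

Lemma scaled_lipschitz u v :
  theta ^+ 2 * dotv (H u - H v) (H u - H v) <=
  p ^+ 3 / 576 * dotv (u - v) (u - v).
Proof.
apply: (@le_trans _ _ ((theta * delta) ^+ 2 * dotv (u - v) (u - v))).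
  by rewrite exprMn -[leRHS]mulrA; apply: ler_wpM2l; [exact: sqr_ge0|exact: Hlip].
by rewrite ler_wpM2r ?dotvv_ge0.
Qed.

(** Expand [|u - e - x|^2] around [u' - e'].  The inner product of the gradient
    with the error [e'] is traded, through the recursion, for the inner product
    of [e'] with the displacement, which the square of the displacement
    absorbs. *)
Lemma inner_step_energy x u u' e e' :
  u' - e' = u - e - theta *: (grad g u' + (H u' - H u)) ->
  dotv (u' - e' - x) (u' - e' - x) - dotv (u - e - x) (u - e - x)
  - 17 / 8 * dotv e' e' - 8^-1 * dotv e e - p / 24 * dotv (u' - x) (u' - x)
  <= 2 * theta * dotv (grad g u') (x - u').
Proof.
move=> rec; case/andP: p01 => p0 p1.
set Dl := theta *: (grad g u' + (H u' - H u)) in rec.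
have gE : theta *: grad g u' = Dl - theta *: (H u' - H u).
  by rewrite /Dl scalerDr addrK.
have uE : u - e = u' - e' + Dl by rewrite rec subrK.
have -> : 2 * theta * dotv (grad g u') (x - u') =
    2 * dotv (theta *: grad g u') (x - u') by rewrite dotvZl mulrA.
rewrite gE uE.
have p24 : 0 < p / 24 by rewrite divr_gt0.
have := youngvN (u' - x) (theta *: (H u' - H u)) p24.
have hh : (p / 24)^-1 * dotv (theta *: (H u' - H u)) (theta *: (H u' - H u))
    <= 24^-1 * dotv (u' - u) (u' - u).
  rewrite dotvvZ -(ler_pM2l p24) mulrA divff ?gt_eqF// mul1r.
  apply: le_trans (scaled_lipschitz _ _) _.
  rewrite mulrA ler_wpM2r ?dotvv_ge0//.
  have : p ^+ 3 <= p.
    by rewrite exprS ler_piMr ?(ltW p0)// expr_le1 ?(ltW p0) ?(ltW p1).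
  lra.
have u3 : dotv (u' - u) (u' - u) <= 3 * dotv Dl Dl + 3 * dotv e' e' + 3 * dotv e e.
  have -> : u' - u = - Dl + e' - e.
    have -> : u = u' - e' + Dl + e by rewrite -uE subrK.
    move: Dl {gE hh rec uE} => Dl.
    by apply/rowP => i; rewrite !mxE; ring.
  by have := sqnormD3 (- Dl) e' (- e); rewrite !dotvvN.
have yD := youngv Dl e' (_ : 0 < 2^-1); rewrite invrK in yD.
have {yD} := yD (ltac:(by [])).
have -> : u' - e' + Dl - x = (u' - e' - x) + Dl by rewrite addrAC.
rewrite (dotvvD (u' - e' - x) Dl).
have -> : x - u' = - (u' - x) by rewrite opprB.
have -> : dotv (u' - e' - x) Dl = dotv (u' - x) Dl - dotv e' Dl.
  by rewrite (addrAC u') (dotvDl (u' - x) (- e') Dl) (dotvNl e').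
rewrite (dotvNr _ (u' - x)) (dotvDl Dl) (dotvNl (theta *: (H u' - H u))).
rewrite (dotvC Dl (u' - x)) (dotvC Dl e') (dotvC (theta *: _) (u' - x)).
move: hh u3 (dotvv_ge0 Dl).
move: (dotv (u' - e' - x) _) (dotv (u' - x) Dl) (dotv e' Dl) (dotv (u' - x) (u' - x)).
move: (dotv (u' - u) _) (dotv Dl Dl) (dotv e' e') (dotv e e).
move: (dotv (u' - x) _) (_^-1 * dotv (theta *: _) _).
by move=> *; lra.
Qed.

Lemma epoch_energy x (u e : nat -> 'rV[R]_d) K : u 0%N = x -> e 0%N = 0 ->
  (forall n, u n.+1 - e n.+1 =
     u n - e n - theta *: (grad g (u n.+1) + (H (u n.+1) - H (u n)))) ->
  \sum_(n < K) p * (1 - p) ^+ n *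
    (11 / 24 * p * dotv (u n.+1 - x) (u n.+1 - x)
     - 13 / 4 * dotv (e n.+1) (e n.+1))
  <= \sum_(n < K) p * (1 - p) ^+ n *
       (2 * theta * dotv (grad g (u n.+1)) (x - u n.+1)).
Proof.
move=> u0 e0 rec; case/andP: (p01) => p0 p1.
pose D n := dotv (u n - e n - x) (u n - e n - x).
pose E n := dotv (e n) (e n); pose U n := dotv (u n - x) (u n - x).
have w0 n := geometric_weight_ge0 n p01.
have E0 : E 0%N = 0 by rewrite /E e0 dotv0l.
have Eshift := geometric_sum_shift K p01 E0 (fun n => dotvv_ge0 (e n)).
have D0 : D 0%N = 0 by rewrite /D u0 e0 subr0 subrr dotv0l.
have parts := geometric_sum_by_parts p D K.
rewrite D0 mulr0 subr0 in parts.
have DK : 0 <= p * (1 - p) ^+ K * D K by rewrite mulr_ge0 ?dotvv_ge0.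
have Dlow n : 2^-1 * U n - E n <= D n.
  have := sqnormD2 (u n - e n - x) (e n); rewrite /D /U /E.
  by rewrite addrAC subrK; lra.
apply: (@le_trans _ _ (\sum_(n < K) p * (1 - p) ^+ n *
    ((D n.+1 - D n) - 17 / 8 * E n.+1 - 8^-1 * E n - p / 24 * U n.+1))); last first.
  by apply: ler_sum => n _; rewrite ler_wpM2l//; exact: inner_step_energy.
have -> : \sum_(n < K) p * (1 - p) ^+ n *
    ((D n.+1 - D n) - 17 / 8 * E n.+1 - 8^-1 * E n - p / 24 * U n.+1) =
  \sum_(n < K) p * (1 - p) ^+ n * (D n.+1 - D n)
  - 17 / 8 * (\sum_(n < K) p * (1 - p) ^+ n * E n.+1)
  - 8^-1 * (\sum_(n < K) p * (1 - p) ^+ n * E n)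
  - p / 24 * (\sum_(n < K) p * (1 - p) ^+ n * U n.+1).
  by rewrite !mulr_sumr -!sumrB; apply: eq_bigr => n _; ring.
have -> : \sum_(n < K) p * (1 - p) ^+ n *
    (11 / 24 * p * dotv (u n.+1 - x) (u n.+1 - x)
     - 13 / 4 * dotv (e n.+1) (e n.+1)) =
  11 / 24 * p * (\sum_(n < K) p * (1 - p) ^+ n * U n.+1) -
  13 / 4 * (\sum_(n < K) p * (1 - p) ^+ n * E n.+1).
  by rewrite !mulr_sumr -!sumrB; apply: eq_bigr => n _; rewrite /U /E; ring.
have SD : 2^-1 * (\sum_(n < K) p * (1 - p) ^+ n * U n.+1)
    - \sum_(n < K) p * (1 - p) ^+ n * E n.+1 <=
    \sum_(n < K) p * (1 - p) ^+ n * D n.+1.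
  rewrite mulr_sumr -sumrB; apply: ler_sum => n _.
  by rewrite mulrCA -mulrBr ler_wpM2l.
have pSD := ler_wpM2l (ltW p0) SD.
have SE : 0 <= \sum_(n < K) p * (1 - p) ^+ n * E n.+1.
  by apply: sumr_ge0 => n _; rewrite mulr_ge0 ?dotvv_ge0.
have pSE : p * (\sum_(n < K) p * (1 - p) ^+ n * E n.+1) <=
    \sum_(n < K) p * (1 - p) ^+ n * E n.+1 by rewrite ler_piMl// ltW.
rewrite parts; move: pSD Eshift pSE SE DK; rewrite mulrBr mulrBl mul1r.
rewrite (mulrCA p 2^-1) -(mulrA _ p) -[p / 24 * _]mulrA (mulrCA p 24^-1).
move: (\sum_(n < K) _ * E n.+1) (\sum_(n < K) _ * U n.+1) => SE SU.
move: (\sum_(n < K) _ * D n.+1) (\sum_(n < K) _ * E n) (_ * D K) => SDD SEE DKK.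
by move: (p * SE) (p * SU) (p * SDD) => *; lra.
Qed.

(** Crude, but it propagates finite second moments along an epoch. *)
Lemma iterate_growth u u' e e' :
  u' - e' = u - e - theta *: (grad g u' + (H u' - H u)) ->
  dotv (u' - xstar) (u' - xstar) <=
  12 * (dotv (u - xstar) (u - xstar) + dotv e e + dotv e' e').
Proof.
move=> rec; case/andP: p01 => p0 p1.
have uE : u' - xstar = (u - xstar) - e + e' - theta *: grad g u'
    - theta *: (H u' - H u).
  rewrite -[in LHS](subrK e' u') rec scalerDr.
  move: (theta *: grad g u') (theta *: _) => a b.
  by apply/rowP => i; rewrite !mxE; ring.
have gpos : 0 <= theta * dotv (grad g u') (u' - xstar).
  apply: mulr_ge0 (ltW theta0) _.
  have := gmu xstar u'; have := gmin u'.
  rewrite -[xstar - u']opprB enorm_sqr dotvvN dotvNr.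
  have : 0 <= mu / 2 * dotv (u' - xstar) (u' - xstar).
    by rewrite mulr_ge0 ?dotvv_ge0// divr_ge0 ?ltW.
  lra.
have hs : theta ^+ 2 * dotv (H u' - H u) (H u' - H u) <=
    288^-1 * (dotv (u' - xstar) (u' - xstar) + dotv (u - xstar) (u - xstar)).
  apply: le_trans (scaled_lipschitz _ _) _.
  have : dotv (u' - u) (u' - u) <=
      2 * dotv (u' - xstar) (u' - xstar) + 2 * dotv (u - xstar) (u - xstar).
    have -> : u' - u = (u' - xstar) - (u - xstar) by rewrite opprB addrA subrK.
    exact: sqnormB2.
  have : p ^+ 3 * dotv (u' - u) (u' - u) <= dotv (u' - u) (u' - u).
    by rewrite ler_piMl ?dotvv_ge0// expr_le1 ?(ltW p0) ?(ltW p1).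
  by rewrite [_ / 576 * _]mulrAC; lra.
have q4 : 0 < 4 :> R by [].
set w := u' - xstar; have e0 : dotv w w = dotv (u - xstar) w - dotv e w
   + dotv e' w - theta * dotv (grad g u') w - dotv (theta *: (H u' - H u)) w.
  rewrite {1}[in LHS]/w {1}uE -/w; move: (theta *: (H u' - H u)) => b.
  by rewrite !dotvDl !dotvNl dotvZl.
have := youngv (u - xstar) w q4; have := youngvN e w q4; have := youngv e' w q4.
have := youngvN (theta *: (H u' - H u)) w q4; rewrite dotvvZ.
move: e0 gpos hs; rewrite -/w.
have := dotvv_ge0 w; have := dotvv_ge0 (u - xstar).
have := dotvv_ge0 e; have := dotvv_ge0 e'.
move: (dotv w w) (dotv (u - xstar) w) (dotv e w) (dotv e' w) => a b c f'.
move: (theta * _) (dotv (theta *: _) w) (theta ^+ 2 * _) => h i j.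
move: (dotv (u - xstar) _) (dotv e e) (dotv e' e') => *; lra.
Qed.

(** The mirror step is a convex quadratic problem, [g] is strongly convex at
    [y'], and [x] lies between [z] and [y]; combining the three, the inner
    product of [grad g y'] with [z] disappears.  What remains is the bias of
    [G], the progress [dotv (grad g y') (y' - x)] and [|G|^2]. *)
Lemma mirror_step (tau alpha : R) x y z y' z' G : 0 < tau < 1 -> 0 < alpha ->
  x = tau *: z + (1 - tau) *: y ->
  z' = (alpha^-1 + mu)^-1 *: (alpha^-1 *: z + mu *: y' - G) ->
  alpha / tau * (g y' - g xstar)
  + (1 + mu * alpha) / 2 * dotv (z' - xstar) (z' - xstar) <=
  (1 - tau) * (alpha / tau * (g y - g xstar))
  + 2^-1 * dotv (z - xstar) (z - xstar)
  + alpha * dotv (G - grad g y') (xstar - z)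
  + alpha / tau * dotv (grad g y') (y' - x)
  + alpha ^+ 2 / 2 * dotv G G.
Proof.
move=> /andP[tau0 tau1] alpha0 xE z'E.
pose k := 1 + mu * alpha; have k0 : 0 < k by rewrite addr_gt0 ?mulr_gt0.
have zE : k *: (z' - xstar) =
    (z - xstar - alpha *: G) + (mu * alpha) *: (y' - xstar).
  have -> : k *: (z' - xstar) = k *: z' - k *: xstar by rewrite scalerBr.
  have -> : k *: z' = z + (mu * alpha) *: y' - alpha *: G.
    have -> : k = alpha * (alpha^-1 + mu).
      by rewrite /k mulrDr divff ?gt_eqF// [alpha * mu]mulrC.
    rewrite z'E -scalerA [_ *: (_^-1 *: _)]scalerA divff; last first.
      by rewrite gt_eqF// addr_gt0 ?invr_gt0.
    rewrite scale1r !scalerDr scalerN !scalerA divff ?gt_eqF// scale1r.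
    by rewrite [alpha * mu]mulrC.
  by rewrite /k; apply/rowP => i; rewrite !mxE; ring.
have sq : k * dotv (z' - xstar) (z' - xstar) <=
    dotv (z - xstar - alpha *: G) (z - xstar - alpha *: G)
    + mu * alpha * dotv (y' - xstar) (y' - xstar).
  rewrite -(ler_pM2l k0) mulrA -expr2 -dotvvZ zE.
  have := dotvv_ge0 (z - xstar - alpha *: G - (y' - xstar)).
  rewrite (dotvvB (z - xstar - alpha *: G)) (dotvvD (z - xstar - alpha *: G)).
  rewrite dotvvZ dotvZr /k.
  move: (dotv (_ - _ - _) (_ - _ - _)) (dotv (y' - xstar) _) (dotv _ (y' - xstar)).
  have ma : 0 < mu * alpha by rewrite mulr_gt0.
  move=> A B C /(mulr_ge0 (ltW ma)).
  by move: (mu * alpha) => c; nra.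
have e1 : dotv (z - xstar - alpha *: G) (z - xstar - alpha *: G) =
    dotv (z - xstar) (z - xstar) - 2 * alpha * dotv G (z - xstar)
    + alpha ^+ 2 * dotv G G.
  by rewrite (dotvvB (z - xstar)) dotvvZ dotvZr (dotvC _ G) mulrA.
have sc := gmu xstar y'; rewrite enorm_sqr (dotvvBC xstar) in sc.
have sy := gmu y y'; rewrite enorm_sqr in sy.
have {}sy : g y' + dotv (grad g y') (y - y') <= g y.
  apply: le_trans sy; rewrite lerDl mulr_ge0 ?dotvv_ge0// divr_ge0 ?ltW//.
have at0 : 0 < alpha / tau by rewrite divr_gt0.
have atE : alpha / tau * tau = alpha by rewrite divfK ?gt_eqF.
have {}sc := ler_wpM2l (ltW alpha0) sc.
have t1 : 0 <= alpha / tau * (1 - tau) by rewrite mulr_ge0 ?(ltW at0)//; lra.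
have {}sy := ler_wpM2l t1 sy.
move: sq; rewrite -/k e1; move: sc sy; rewrite xE.
set q := grad g y'.
rewrite (dotvDl G (- q)) dotvNl !(dotvDr _ (- _)) !dotvNr (dotvDr (tau *: z)) !dotvZr.
move: atE; move: (alpha / tau) => c; rewrite -/k; move: (k) => l <-.
move=> *; lra.
Qed.

(** In [B] the bias of the gradient surrogate telescopes, so that the weighted
    sum leaves the boundary term in [B k.+1] alone.  Young's inequality with the
    weight [p theta / (28 tau)] splits it into a part that the last summand of
    the progress absorbs and the multiple of [(1 - p) ^+ k] in the conclusion.
    The remaining errors come with the factor [6], matching the [p / 6] on the
    left and the [p / 36] of [weighted_error_bound]. *)
Lemma outer_step_pathwise (tau alpha : R) x y z (u e zz : nat -> 'rV[R]_d) k :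
  0 < tau < 1 -> 0 < alpha -> 28 * alpha * p * tau <= theta ->
  x = tau *: z + (1 - tau) *: y -> u 0%N = x -> e 0%N = 0 ->
  (forall n, u n.+1 - e n.+1 =
     u n - e n - theta *: (grad g (u n.+1) + (H (u n.+1) - H (u n)))) ->
  (forall n, zz n = (alpha^-1 + mu)^-1 *: (alpha^-1 *: z + mu *: u n -
     p *: ((H x - H (u n)) + theta^-1 *: (x - (u n - e n))))) ->
  \sum_(n < k.+1) p * (1 - p) ^+ n *
    (alpha / tau * (g (u n.+1) - g xstar)
     + (1 + mu * alpha) / 2 * dotv (zz n.+1 - xstar) (zz n.+1 - xstar))
  + alpha / (2 * theta * tau) * (p / 6 *
    \sum_(n < k.+1) p * (1 - p) ^+ n * dotv (u n.+1 - x) (u n.+1 - x)) <=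
  (1 - tau) * (alpha / tau * (g y - g xstar))
  + 2^-1 * dotv (z - xstar) (z - xstar)
  + 14 * alpha * tau / theta * (1 - p) ^+ k * dotv (z - xstar) (z - xstar)
  + alpha / (2 * theta * tau) * (6 *
    \sum_(n < k.+1) p * (1 - p) ^+ n * dotv (e n.+1) (e n.+1)).
Proof.
move=> tau01 alpha0 small xE u0 e0 rec zzE; have /andP[tau0 tau1] := tau01.
have /andP[p0 p1] := p01.
pose V n := theta^-1 *: (u n - e n) + H (u n).
pose G n := p *: ((H x - H (u n)) + theta^-1 *: (x - (u n - e n))).
pose v := xstar - z; pose B n := dotv (V n - V 0%N) v.
pose Psi := (1 - tau) * (alpha / tau * (g y - g xstar))
  + 2^-1 * dotv (z - xstar) (z - xstar).
pose kap := alpha / (2 * theta * tau).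
pose U n := dotv (u n - x) (u n - x); pose E n := dotv (e n) (e n).
have tn : theta != 0 by rewrite gt_eqF.
have GE n : G n = - p *: (V n - V 0%N).
  rewrite /G /V u0 e0; move: (H (u n)) (H x) (u n) (e n) => a b c f'.
  by apply/rowP => i; rewrite !mxE; ring.
have gE n : grad g (u n.+1) = (V n - V 0%N) - (V n.+1 - V 0%N).
  rewrite /V rec; move: (grad g _) (H (u n.+1)) (H (u n)) (V 0%N) (u n) (e n).
  by move=> a b c f' h l; apply/rowP => i; rewrite !mxE; field.
have Vsmall n : theta ^+ 2 * dotv (V n - V 0%N) (V n - V 0%N) <= 4 * U n + 3 * E n.
  have h : theta *: (V n - V 0%N) = (u n - x) + (- e n) + theta *: (H (u n) - H x).
    rewrite /V u0 e0; move: (H (u n)) (H x) (u n) (e n) => a b c f'.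
    by apply/rowP => i; rewrite !mxE; field.
  rewrite -dotvvZ h; apply: le_trans (sqnormD3 _ _ _) _; rewrite dotvvN dotvvZ.
  have := scaled_lipschitz (u n) x; rewrite -/(U n) -/(E n).
  have : p ^+ 3 * U n <= U n.
    by rewrite ler_piMl ?dotvv_ge0// expr_le1 ?(ltW p0) ?(ltW p1).
  by have := dotvv_ge0 (u n - x); rewrite -/(U n) [_ / 576 * _]mulrAC; lra.
have kap0 : 0 < kap by rewrite divr_gt0// !mulr_gt0.
have w0 n := geometric_weight_ge0 n p01.
have atk : alpha / tau = 2 * theta * kap.
  by rewrite /kap; field; rewrite tn gt_eqF.
have Gsmall n : alpha ^+ 2 / 2 * dotv (G n) (G n) <=
    kap * (p / 28) * (4 * U n + 3 * E n).
  rewrite GE dotvvZ sqrrN.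
  apply: (@le_trans _ _ (kap * (p / 28) *
      (theta ^+ 2 * dotv (V n - V 0%N) (V n - V 0%N)))); last first.
    by rewrite ler_wpM2l// ltW// mulr_gt0// divr_gt0.
  rewrite [leLHS]mulrA [leRHS]mulrA ler_wpM2r ?dotvv_ge0//.
  have -> : kap * (p / 28) * theta ^+ 2 = alpha * p / (56 * tau) * theta.
    by rewrite /kap; field; rewrite tn gt_eqF.
  have -> : alpha ^+ 2 / 2 * p ^+ 2 = alpha * p / (56 * tau) * (28 * alpha * p * tau).
    by field; rewrite gt_eqF.
  by rewrite ler_wpM2l// ltW// divr_gt0 ?mulr_gt0.
have step n : alpha / tau * (g (u n.+1) - g xstar)
     + (1 + mu * alpha) / 2 * dotv (zz n.+1 - xstar) (zz n.+1 - xstar) <=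
   Psi + alpha * (B n.+1 - B n - p * B n.+1)
   - kap * (2 * theta * dotv (grad g (u n.+1)) (x - u n.+1))
   + kap * (p / 28) * (4 * U n.+1 + 3 * E n.+1).
  apply: le_trans (mirror_step tau01 alpha0 xE (zzE n.+1)) _.
  rewrite -/(G _) -/v; apply: lerD (Gsmall _).
  have -> : alpha / tau * dotv (grad g (u n.+1)) (u n.+1 - x) =
      - (kap * (2 * theta * dotv (grad g (u n.+1)) (x - u n.+1))).
    by rewrite -[u n.+1 - x]opprB dotvNr atk; ring.
  rewrite -/Psi lerD2r lerD2l ler_pM2l// gE GE (dotvDl (- p *: _)) dotvZl dotvNl.
  by rewrite (dotvDl (V n - V 0%N)) dotvNl -/(B _) -/(B _); lra.
have bdry : alpha * B k.+1 <= kap * (p / 28) * (4 * U k.+1 + 3 * E k.+1)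
    + 14 * alpha * tau / (p * theta) * dotv (z - xstar) (z - xstar).
  have t0 : 0 < p * theta / (28 * tau) by rewrite divr_gt0 ?mulr_gt0.
  have := ler_wpM2l (ltW alpha0) (youngv (V k.+1 - V 0%N) v t0).
  have := ler_wpM2l (_ : 0 <= kap * (p / 28)) (Vsmall k.+1).
  have kp : 0 <= kap * (p / 28) by rewrite ltW// mulr_gt0// divr_gt0.
  move=> /(_ kp); rewrite -/(B _) (_ : dotv v v = dotv (z - xstar) (z - xstar)); last first.
    exact: dotvvBC.
  move: (dotv (V _ - _) _) (dotv (z - _) _) => a b.
  have -> : kap * (p / 28) * (theta ^+ 2 * a) =
      2^-1 * (alpha * (p * theta / (28 * tau) * a)).
    by rewrite /kap; field; rewrite tn gt_eqF.
  have -> : 14 * alpha * tau / (p * theta) * b =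
      2^-1 * (alpha * ((p * theta / (28 * tau))^-1 * b)).
    by field; rewrite tn !gt_eqF.
  rewrite !mulrDr; lra.
have energy := epoch_energy k.+1 u0 e0 rec.
have parts := geometric_sum_by_parts p B k.+1.
have B0 : B 0%N = 0 by rewrite /B subrr dotv0l.
have Psi0 : 0 <= Psi.
  apply: addr_ge0; last by rewrite mulr_ge0 ?dotvv_ge0// invr_ge0.
  by rewrite !mulr_ge0 ?invr_ge0 ?subr_ge0 ?(ltW tau1) ?(ltW tau0) ?(ltW alpha0).
set SU := \sum_(n < k.+1) p * (1 - p) ^+ n * dotv (u n.+1 - x) (u n.+1 - x).
set SE := \sum_(n < k.+1) p * (1 - p) ^+ n * dotv (e n.+1) (e n.+1).
set LHS := \sum_(n < k.+1) _ * (alpha / tau * _ + _).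
have main : LHS <= \sum_(n < k.+1) p * (1 - p) ^+ n *
   (Psi + alpha * (B n.+1 - B n - p * B n.+1)
   - kap * (2 * theta * dotv (grad g (u n.+1)) (x - u n.+1))
   + kap * (p / 28) * (4 * U n.+1 + 3 * E n.+1)).
  by apply: ler_sum => n _; rewrite ler_wpM2l.
have sumE : \sum_(n < k.+1) p * (1 - p) ^+ n *
   (Psi + alpha * (B n.+1 - B n - p * B n.+1)
   - kap * (2 * theta * dotv (grad g (u n.+1)) (x - u n.+1))
   + kap * (p / 28) * (4 * U n.+1 + 3 * E n.+1)) =
   (\sum_(n < k.+1) p * (1 - p) ^+ n) * Psi
   + alpha * (p * (1 - p) ^+ k.+1 * B k.+1)
   - kap * (\sum_(n < k.+1) p * (1 - p) ^+ n *
       (2 * theta * dotv (grad g (u n.+1)) (x - u n.+1)))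
   + kap * (p / 28) * (4 * SU + 3 * SE).
  have -> : p * (1 - p) ^+ k.+1 * B k.+1 =
      \sum_(n < k.+1) p * (1 - p) ^+ n * (B n.+1 - B n)
      - p * (\sum_(n < k.+1) p * (1 - p) ^+ n * B n.+1).
    by rewrite parts B0; ring.
  rewrite /SU /SE; elim: (k.+1) => [|K IH]; first by rewrite !big_ord0; ring.
  by rewrite !big_ord_recr /= IH /U /E; ring.
have Psum : (\sum_(n < k.+1) p * (1 - p) ^+ n) * Psi <= Psi.
  by rewrite ler_piMl// geometric_weights_sum gerBl exprn_ge0//; lra.
have energy' : 11 / 24 * (p * SU) - 13 / 4 * SE <=
   \sum_(n < k.+1) p * (1 - p) ^+ n *
       (2 * theta * dotv (grad g (u n.+1)) (x - u n.+1)).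
  apply: le_trans energy; rewrite /SU /SE mulrA !mulr_sumr -sumrB.
  by rewrite le_eqVlt; apply/orP; left; apply/eqP; apply: eq_bigr => n _; ring.
have U0 n : 0 <= U n := dotvv_ge0 _; have E0 n : 0 <= E n := dotvv_ge0 _.
have SUk : p * (1 - p) ^+ k * U k.+1 <= SU.
  rewrite /SU big_ord_recr /= lerDr; apply: sumr_ge0 => n _.
  exact: mulr_ge0 (w0 n) (U0 _).
have SEk : p * (1 - p) ^+ k * E k.+1 <= SE.
  rewrite /SE big_ord_recr /= lerDr; apply: sumr_ge0 => n _.
  exact: mulr_ge0 (w0 n) (E0 _).
have SE0 : 0 <= SE by apply: sumr_ge0 => n _; exact: mulr_ge0 (w0 n) (E0 _).
have SU0 : 0 <= SU by apply: sumr_ge0 => n _; exact: mulr_ge0 (w0 n) (U0 _).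
set b := dotv (z - xstar) (z - xstar) in bdry *.
have b0 : 0 <= b := dotvv_ge0 _.
have bdry' : alpha * (p * (1 - p) ^+ k.+1 * B k.+1) <=
    kap * (p / 28) * (4 * SU + 3 * SE)
    + 14 * alpha * tau / theta * (1 - p) ^+ k * b.
  set c := _ + 14 * alpha * tau / (p * theta) * b in bdry.
  have kp : 0 <= kap * (p / 28) by rewrite ltW// mulr_gt0// divr_gt0.
  have c0 : 0 <= c.
    rewrite addr_ge0// mulr_ge0//; first by rewrite addr_ge0// mulr_ge0.
    by rewrite ltW// divr_gt0 ?mulr_gt0.
  apply: (@le_trans _ _ (p * (1 - p) ^+ k * c)).
    have -> : alpha * (p * (1 - p) ^+ k.+1 * B k.+1) =
       p * (1 - p) ^+ k * ((1 - p) * (alpha * B k.+1)) by rewrite exprS; ring.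
    rewrite ler_wpM2l//; apply: (@le_trans _ _ ((1 - p) * c)).
      by rewrite ler_wpM2l//; lra.
    by rewrite ler_piMl//; lra.
  have -> : p * (1 - p) ^+ k * c = kap * (p / 28) *
      (4 * (p * (1 - p) ^+ k * U k.+1) + 3 * (p * (1 - p) ^+ k * E k.+1))
      + 14 * alpha * tau / theta * (1 - p) ^+ k * b.
    by rewrite /c; field; rewrite tn gt_eqF.
  by rewrite lerD2r ler_wpM2l//; lra.
rewrite -/Psi -/kap; apply: (@le_trans _ _ (Psi +
  (kap * (p / 28) * (4 * SU + 3 * SE)
    + 14 * alpha * tau / theta * (1 - p) ^+ k * b)
  - kap * (11 / 24 * (p * SU) - 13 / 4 * SE)
  + kap * (p / 28) * (4 * SU + 3 * SE) + kap * (p / 6 * SU))).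
  rewrite lerD2r; apply: le_trans main _; rewrite sumE lerD2r.
  by rewrite lerB ?ler_pM2l// lerD.
rewrite -subr_ge0.
have -> : Psi + 14 * alpha * tau / theta * (1 - p) ^+ k * b + kap * (6 * SE)
  - (Psi + (kap * (p / 28) * (4 * SU + 3 * SE)
    + 14 * alpha * tau / theta * (1 - p) ^+ k * b)
  - kap * (11 / 24 * (p * SU) - 13 / 4 * SE)
  + kap * (p / 28) * (4 * SU + 3 * SE) + kap * (p / 6 * SU)) =
  kap * (168^-1 * (p * SU) + (11 / 4 - 3 / 14 * p) * SE) by field.
rewrite mulr_ge0 ?(ltW kap0)// addr_ge0//.
  by rewrite mulr_ge0 ?invr_ge0// mulr_ge0// ltW.
by rewrite mulr_ge0//; lra.
Qed.

End Pathwise.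

(** * Borel measurability of random vectors *)

Section BorelVectors.
Context {R : realType} {d : nat} {dT : measure_display} {T : measurableType dT}.
Implicit Types (X Y : T -> 'rV[R]_d).

Definition measurable_vec X := measurable_fun [set: T] (X : T -> borelRV R d).

(** Open sets are countable unions of rational cubes, so the Borel sets are
    generated by the coordinates. *)
Lemma measurable_vec_coord X : (forall i, measurable_fun setT (fun t => X t 0 i)) ->
  measurable_vec X.
Proof.
move=> Xi; apply: (@measurability _ _ _ (borelRV R d) _ _ (@open 'rV[R]_d)) => //.
move=> _ [U oU <-].
rewrite setTI.
pose Box (qn : 'rV[rat]_d * nat) : set 'rV[R]_d :=
  [set x | forall i, `|x 0 i - ratr (qn.1 0 i)| < qn.2.+1%:R^-1].
pose F qn := if `[< Box qn `<=` U >] then X @^-1` Box qn else set0.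
have -> : X @^-1` U = \bigcup_qn F qn.
  apply/seteqP; split => [t Ut|t [qn _]]; last first.
    by rewrite /F; case: ifPn => // /asboolP; apply.
  have [e /= e0 eU] := (nbhs_ballP _ _).1 (open_nbhs_nbhs (conj oU Ut)).
  have [n ne] : exists n, n.+1%:R^-1 < e / 2.
    have e2 : 0 < e / 2 by rewrite divr_gt0.
    by have [n] := ltr_add_invr e2; rewrite add0r; exists n.
  have n0 : 0 < n.+1%:R^-1 :> R by rewrite invr_gt0.
  have xq i : exists q : rat, `|X t 0 i - ratr q| < n.+1%:R^-1.
    move: (n.+1%:R^-1) (X t 0 i) n0 => r x r0.
    have : x - r < x + r by lra.
    move=> /rat_in_itvoo [q]; rewrite in_itv /= => /andP[q1 q2].
    by exists q; rewrite ltr_norml; apply/andP; split; lra.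
  pose q : 'rV[rat]_d := \row_i sval (cid (xq i)).
  have qP i : `|X t 0 i - ratr (q 0 i)| < n.+1%:R^-1.
    by rewrite mxE; exact: svalP (cid (xq i)).
  exists (q, n) => //; rewrite /F ifT; first exact: qP.
  apply/asboolP => y /= yq; apply: eU; split => // i j.
  rewrite (ord1 i) /ball /=.
  have -> : X t 0 j - y 0 j = (X t 0 j - ratr (q 0 j)) - (y 0 j - ratr (q 0 j)).
    by ring.
  apply: le_lt_trans (ler_normB _ _) _.
  by move: (qP j) (yq j) ne; move: (n.+1%:R^-1) => r *; lra.
apply: countable_bigcupT_measurable => [|qn]; first exact: countableP.
rewrite /F; case: ifPn => // _.
have -> : X @^-1` Box qn =
    \bigcap_(i in [set: 'I_d]) ((fun t => X t 0 i) @^-1`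
       [set r | `|r - ratr (qn.1 0 i)| < qn.2.+1%:R^-1]).
  by apply/seteqP; split => [t Bt i _|t Bt i]; [exact: Bt|exact: Bt].
apply: fin_bigcap_measurable; first exact: finite_finset.
move=> i _; rewrite -[X in measurable X]setTI; apply: Xi => //.
have -> : [set r | `|r - ratr (qn.1 0 i)| < qn.2.+1%:R^-1] =
    ball (ratr (qn.1 0 i) : R) qn.2.+1%:R^-1.
  by apply/seteqP; split => r; rewrite /ball /= distrC.
exact: measurable_ball.
Qed.

Lemma measurable_coord X i : measurable_vec X -> measurable_fun setT (fun t => X t 0 i).
Proof.
move=> mX; apply: (measurability _ (RGenOpens.measurableE R)).
move=> _ [_ [a [b ->] <-]].
have -> : (fun t => X t 0 i) @^-1` `]a, b[%classic =
   X @^-1` ((fun v : 'rV[R]_d => v 0 i) @^-1` `]a, b[%classic) by [].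
apply: mX => //; apply: sub_sigma_algebra.
have oab : open (`]a, b[%classic : set R) by exact: interval_open.
have /continuousP : continuous (fun v : 'rV[R]_d => v 0 i).
  by move=> v; exact: (@coord_continuous R 1 d 0 i).
by apply.
Qed.

Lemma measurable_vec_comp (F : 'rV[R]_d -> 'rV[R]_d) X :
  continuous F -> measurable_vec X -> measurable_vec (F \o X).
Proof.
move=> cF mX; apply: (@measurability _ _ _ (borelRV R d) _ _ (@open 'rV[R]_d)) => //.
move=> _ [U oU <-]; rewrite comp_preimage.
by apply: mX => //; apply: sub_sigma_algebra; exact: (continuousP _).1 cF _ oU.
Qed.

Lemma measurable_real_comp (h : 'rV[R]_d -> R) X :
  continuous h -> measurable_vec X -> measurable_fun setT (h \o X).
Proof.
move=> ch mX; apply: (measurability _ (RGenOpens.measurableE R)).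
move=> _ [_ [a [b ->] <-]]; rewrite comp_preimage.
apply: mX => //; apply: sub_sigma_algebra.
have oab : open (`]a, b[%classic : set R) by exact: interval_open.
by move/continuousP : ch; apply.
Qed.

Lemma measurable_vecD X Y : measurable_vec X -> measurable_vec Y ->
  measurable_vec (fun t => X t + Y t).
Proof.
move=> mX mY; apply: measurable_vec_coord => i.
rewrite (_ : (fun t => _) = (fun t => X t 0 i) \+ (fun t => Y t 0 i)).
  by apply: measurable_funD; exact: measurable_coord.
by apply/funext => t; rewrite mxE.
Qed.

Lemma measurable_vecZ (a : R) X : measurable_vec X ->
  measurable_vec (fun t => a *: X t).
Proof.
by move=> mX; apply: (@measurable_vec_comp ( *:%R a)) => //; exact: scaler_continuous.
Qed.

Lemma measurable_vecN X : measurable_vec X -> measurable_vec (fun t => - X t).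
Proof.
move=> mX; rewrite (_ : (fun t => _) = fun t => (-1) *: X t).
  exact: measurable_vecZ.
by apply/funext => t; rewrite scaleN1r.
Qed.

Lemma measurable_vecB X Y : measurable_vec X -> measurable_vec Y ->
  measurable_vec (fun t => X t - Y t).
Proof. by move=> mX mY; apply: measurable_vecD => //; exact: measurable_vecN. Qed.

Lemma measurable_vec_cst (v : 'rV[R]_d) : measurable_vec (fun=> v).
Proof. exact: measurable_cst. Qed.

Lemma measurable_vec_sum n (X : 'I_n -> T -> 'rV[R]_d) :
  (forall i, measurable_vec (X i)) -> measurable_vec (fun t => \sum_(i < n) X i t).
Proof.
move=> mX; apply: measurable_vec_coord => j.
rewrite (_ : (fun t => _) = fun t => \sum_(i < n) X i t 0 j).
  by apply: measurable_sum => i; exact: measurable_coord.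
by apply/funext => t; rewrite summxE.
Qed.

Lemma measurable_vec_avg n (X : 'I_n -> T -> 'rV[R]_d) :
  (forall i, measurable_vec (X i)) -> measurable_vec (fun t => avg (X^~ t)).
Proof. by move=> mX; apply: measurable_vecZ; exact: measurable_vec_sum. Qed.

Lemma measurable_sqnorm X : measurable_vec X ->
  measurable_fun setT (fun t => dotv (X t) (X t)).
Proof.
move=> mX; apply: measurable_sum => i.
by apply: measurable_funM; exact: measurable_coord.
Qed.

End BorelVectors.

(** * Independence *)

Section Independence.
Context {R : realType} {dO : measure_display} {Omega : measurableType dO}.
Variables (P : probability Omega R) (I : eqType) (F : I -> set (set Omega)).
Hypothesis Fsigma : forall i, sigma_algebra setT (F i).
Hypothesis Fmeas : forall i, F i `<=` measurable.
Hypothesis indep : mutually_independent P F.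

(** Generators of the information carried by the variables indexed by [J]. *)
Definition history (J : set I) := \bigcup_(i in J) F i.

Lemma history_sub J : <<s history J >> `<=` measurable.
Proof.
apply: smallest_sub; first exact: sigma_algebra_measurable.
by move=> A [i _ FA]; exact: Fmeas FA.
Qed.

Lemma history_mono (J J' : set I) : J `<=` J' ->
  <<s history J >> `<=` <<s history J' >>.
Proof.
move=> JJ'; apply: smallest_sub; first exact: smallest_sigma_algebra.
by move=> A [i Ji FA]; apply: sub_sigma_algebra; exists i => //; exact: JJ'.
Qed.

Local Open Scope ereal_scope.

(** Finite intersections of events of the [F i], [i] in [J], form a pi-system on
    which independence from [A] is the product rule; the pi-lambda theorem
    extends it. *)
Lemma independent_history (J : set I) i0 A B : ~ J i0 -> F i0 A ->
  <<s history J >> B -> P (A `&` B) = P A * P B.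
Proof.
move=> Ji0 FA; have mA := Fmeas FA.
pose Pi : set (set Omega) := [set B | exists (s : seq I) (E : I -> set Omega),
  [/\ uniq s, forall i, i \in s -> J i /\ F i (E i) &
      B = \bigcap_(i in [set` s]) E i]].
pose H := [set B | measurable B /\ P (A `&` B) = P A * P B].
have FI i C D : F i C -> F i D -> F i (C `&` D).
  move=> FC FD; have := @measurableI _ (g_sigma_algebraType (F i)) C D.
  by rewrite /measurable /= sigma_algebra_id//; apply.
have FT i : F i setT.
  have := @measurableT _ (g_sigma_algebraType (F i)).
  by rewrite /measurable /= sigma_algebra_id.
have PiI : setI_closed Pi.
  move=> _ _ [s [E [us sJ ->]]] [s' [E' [us' sJ' ->]]].
  exists (undup (s ++ s')), (fun i => (if i \in s then E i else setT) `&`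
     (if i \in s' then E' i else setT)); split; first exact: undup_uniq.
    move=> i; rewrite mem_undup mem_cat => /orP is_; split.
      by case: is_ => [/sJ[]|/sJ'[]].
    by apply: FI; case: ifPn => // h; [have [] := sJ _ h|have [] := sJ' _ h].
  apply/seteqP; split => [w [wE wE'] i _|w h].
    by split; case: ifPn => // h; [exact: wE|exact: wE'].
  split => i /= is_.
    have := h i; rewrite /= mem_undup mem_cat is_ => /(_ isT) [].
    by [].
  have := h i; rewrite /= mem_undup mem_cat is_ orbT => /(_ isT) [_].
  by [].
have PiH : Pi `<=` H.
  move=> _ [s [E [us sJ ->]]]; split.
    apply: fin_bigcap_measurable; [exact: finite_seq|by move=> i /sJ [_ /Fmeas]].
  pose E' i := if i == i0 then A else E i.
  have i0s : i0 \notin s by apply/negP => /sJ [].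
  have E'0 : E' i0 = A by rewrite /E' eqxx.
  have := @indep (i0 :: s) E'.
  rewrite /= i0s us => /(_ isT); rewrite big_cons E'0.
  have -> : (\prod_(j <- s) P (E' j) = P (\bigcap_(i in [set` s]) E i)).
    rewrite (indep us) => [|i /sJ[]//].
    apply: eq_big_seq => i is_; rewrite /E' ifN//.
    by apply: contraNneq i0s => <-.
  move=> <-; last first.
    move=> i; rewrite inE /E' => /orP[/eqP -> |is_]; first by rewrite eqxx.
    by case: eqVneq => [-> //|_]; have [] := sJ i is_.
  congr (P _); apply/seteqP; split => [w [wA wE] i|w h].
    rewrite /= inE /E'; case: eqVneq => //= _ is_; exact: wE.
  split; first by have := h i0; rewrite /= inE eqxx /E' eqxx; apply.
  move=> i /= is_; have := h i; rewrite /= inE is_ orbT /E'.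
  by case: eqVneq => [ii0|_]; [rewrite ii0 (negPf i0s) in is_|apply].
have Hl : lambda_system setT H.
  apply/dynkin_lambda_system; split.
  - by split => //; rewrite setIT probability_setT mule1.
  - move=> {}B [mB PB]; split; first exact: measurableC.
    have PAfin : P A \is a fin_num by exact: fin_num_measure.
    have PBfin : P B \is a fin_num by exact: fin_num_measure.
    have PAoo : P A < +oo by rewrite -ge0_fin_numE.
    have -> : A `&` ~` B = A `\` B by rewrite setDE.
    have -> : P (A `\` B) = P A - P (A `&` B) by exact: measureD.
    rewrite PB probability_setC//.
    by rewrite muleBr ?mule1// fin_num_adde_defr.
  - move=> D tD HD; have mD n : measurable (D n) by have [] := HD n.
    split; first exact: bigcup_measurable.
    rewrite setI_bigcupr measure_bigcup//=; last 2 first.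
      by move=> n _; exact: measurableI.
      exact: trivIset_setIl.
    rewrite measure_bigcup//=.
    rewrite -(fineK (fin_num_measure P _ mA)) -nneseriesZl//.
    apply: eq_eseriesr => n _; rewrite (fineK (fin_num_measure P _ mA)).
    by have [] := HD n.
have sub : <<s history J >> `<=` <<s Pi >>.
  apply: smallest_sub; first exact: smallest_sigma_algebra.
  move=> C [i Ji FC]; apply: sub_sigma_algebra.
  exists [:: i], (fun=> C); split => // [j|].
    by rewrite inE => /eqP ->.
  by apply/seteqP; split => [w wC j _//|w /(_ i)]; rewrite /= inE eqxx; apply.
move=> /sub; have := @lambda_system_subset _ _ PiI setT _ Hl PiH.
by move=> /(_ (fun _ _ _ _ => Logic.I)) /[apply] -[].
Qed.

(** The joint law of [V] and [X] is a product, so Tonelli's theorem lets one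
    average over [V] with [X] frozen. *)
Lemma expectation_independent (J : set I) i0 d1 (T1 : measurableType d1)
    d2 (T2 : measurableType d2) (V : {RV P >-> T1}) (X : Omega -> T2)
    (phi : T1 * T2 -> \bar R) :
  ~ J i0 -> g_sigma_algebra_preimage V `<=` F i0 ->
  @measurable_fun _ _ (g_sigma_algebraType (history J)) T2 setT X ->
  measurable_fun setT phi -> (forall vx, 0 <= phi vx) ->
  \int[P]_w phi (V w, X w) =
  \int[P]_w \int[distribution P V]_v phi (v, X w).
Proof.
move=> Ji0 VF mX mphi phi0.
have mX' : @measurable_fun _ _ Omega T2 setT X.
  by move=> _ B mB; apply: (@history_sub J); exact: mX.
pose Xf : {mfun Omega >-> T2} := HB.pack X (isMeasurableFun.Build _ _ _ _ _ mX').
have mVX : measurable_fun setT (fun w => (V w, X w)).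
  by apply: measurable_fun_pair.
pose VX : {mfun Omega >-> (T1 * T2)%type} :=
  HB.pack (fun w => (V w, X w)) (isMeasurableFun.Build _ _ _ _ _ mVX).
transitivity (\int[distribution P VX]_z phi z).
  by rewrite ge0_integral_distribution.
transitivity (\int[distribution P V \x distribution P Xf]_z phi z).
  apply: eq_measure_integral => Z mZ _; apply/esym.
  apply: product_measure_unique => // A B mA mB.
  change (P (V @^-1` A `&` X @^-1` B) = P (V @^-1` A) * P (X @^-1` B)).
  apply: (@independent_history J i0) => //.
    by apply: VF; exists A => //; rewrite setTI.
  by rewrite -[X @^-1` B]setTI; exact: mX.
rewrite fubini_tonelli2// (@ge0_integral_distribution _ _ _ _ _ P Xf)//.
  exact: measurable_fun_fubini_tonelli_G.
by move=> x; exact: integral_ge0.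
Qed.

End Independence.

(** * Expectations of nonnegative random variables *)

Section NonnegativeExpectation.
Context {R : realType} {dO : measure_display} {Omega : measurableType dO}.
Variable P : probability Omega R.
Implicit Types X Y : Omega -> R.
Local Open Scope ereal_scope.

Lemma ge0_expectation_le X Y : measurable_fun setT X -> measurable_fun setT Y ->
  (forall w, 0 <= X w)%R -> (forall w, X w <= Y w)%R ->
  \int[P]_w (X w)%:E <= \int[P]_w (Y w)%:E.
Proof.
move=> mX mY X0 XY; apply: ge0_le_integral => //.
- by move=> w _; rewrite lee_fin.
- exact/measurable_EFinP.
- exact/measurable_EFinP.
- by move=> w _; rewrite lee_fin.
Qed.

Lemma ge0_expectationD X Y : measurable_fun setT X -> measurable_fun setT Y ->
  (forall w, 0 <= X w)%R -> (forall w, 0 <= Y w)%R ->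
  \int[P]_w (X w + Y w)%:E = \int[P]_w (X w)%:E + \int[P]_w (Y w)%:E.
Proof.
move=> mX mY X0 Y0; under eq_integral do rewrite EFinD.
apply: ge0_integralD => //; first by move=> w _; rewrite lee_fin.
- exact/measurable_EFinP.
- by move=> w _; rewrite lee_fin.
- exact/measurable_EFinP.
Qed.

Lemma ge0_expectationZ (a : R) X : measurable_fun setT X ->
  (forall w, 0 <= X w)%R -> (0 <= a)%R ->
  \int[P]_w (a * X w)%:E = a%:E * \int[P]_w (X w)%:E.
Proof.
move=> mX X0 a0; under eq_integral do rewrite EFinM.
apply: ge0_integralZl_EFin => //; first by move=> w _; rewrite lee_fin.
exact/measurable_EFinP.
Qed.

Lemma ge0_expectation_sum n (a : 'I_n -> R) (X : 'I_n -> Omega -> R) :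
  (forall i, measurable_fun setT (X i)) -> (forall i w, 0 <= X i w)%R ->
  (forall i, 0 <= a i)%R ->
  \int[P]_w (\sum_(i < n) a i * X i w)%R%:E =
  \sum_(i < n) (a i)%:E * \int[P]_w (X i w)%:E.
Proof.
move=> mX X0 a0; under eq_integral do rewrite -sumEFin.
rewrite ge0_integral_sum//.
- by apply: eq_bigr => i _; rewrite -ge0_expectationZ.
- by move=> i; apply/measurable_EFinP; apply: measurable_funM.
- by move=> i w _; rewrite lee_fin mulr_ge0.
Qed.

End NonnegativeExpectation.

Section RandomIndex.
Context {R : realType} {dO : measure_display} {Omega : measurableType dO}.
Variables (P : probability Omega R) (I : eqType) (F : I -> set (set Omega)).
Hypothesis Fsigma : forall i, sigma_algebra setT (F i).
Hypothesis Fmeas : forall i, F i `<=` measurable.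
Hypothesis indep : mutually_independent P F.

Notation known J := (g_sigma_algebraType (history F J)).

Lemma measurable_history_mono (J J' : set I) d (T : measurableType d)
    (X : Omega -> T) : J `<=` J' ->
  @measurable_fun _ _ (known J) T setT X -> @measurable_fun _ _ (known J') T setT X.
Proof.
move=> JJ' mX _ B mB; rewrite setTI; apply: (history_mono JJ').
by rewrite -[X @^-1` B]setTI; exact: mX.
Qed.

Lemma measurable_history (J : set I) d (T : measurableType d) (X : Omega -> T) :
  @measurable_fun _ _ (known J) T setT X -> measurable_fun setT X.
Proof. by move=> mX _ B mB; apply: (history_sub Fmeas); exact: mX. Qed.

Lemma measurable_known (J : set I) i d (T : measurableType d) (X : Omega -> T) :
  J i -> g_sigma_algebra_preimage X `<=` F i ->
  @measurable_fun _ _ (known J) T setT X.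
Proof.
move=> Ji XF _ B mB; apply: sub_sigma_algebra; exists i => //.
by apply: XF; exists B.
Qed.

Lemma measurable_random_index dT (T : measurableType dT) (K : T -> nat)
    d (E : measurableType d) (X : nat -> T -> E) :
  measurable_fun setT K -> (forall n, measurable_fun setT (X n)) ->
  measurable_fun setT (fun w => X (K w) w).
Proof.
move=> mK mX _ B mB; rewrite setTI.
have -> : (fun w => X (K w) w) @^-1` B =
    \bigcup_n (K @^-1` [set n] `&` X n @^-1` B).
  apply/seteqP; split => [w Bw|w [n _ [/= <-]]]//.
  by exists (K w).
apply: bigcupT_measurable => n; apply: measurableI.
  by rewrite -[X in measurable X]setTI; exact: mK.
by rewrite -[X in measurable X]setTI; exact: mX.
Qed.

Local Open Scope ereal_scope.

(** Split over the events [K = n], each independent of [X n]. *)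
Lemma expectation_random_index (J : set I) i0 (K : {RV P >-> nat})
    (X : nat -> Omega -> R) :
  ~ J i0 -> g_sigma_algebra_preimage K `<=` F i0 ->
  (forall n, @measurable_fun _ _ (known J) R setT (X n)) ->
  (forall n w, 0 <= X n w)%R ->
  \int[P]_w (X (K w) w)%:E =
  \sum_(n <oo) P (K @^-1` [set n]) * \int[P]_w (X n w)%:E.
Proof.
move=> Ji0 KF mX X0; have mX' n := measurable_history (mX n).
have mK n : measurable (K @^-1` [set n]).
  by rewrite -[X in measurable X]setTI; exact: measurable_funP.
have mXK : measurable_fun setT (fun w => X (K w) w).
  by apply: measurable_random_index => //; exact: measurable_funP.
have -> : \int[P]_w (X (K w) w)%:E =
    \int[P]_(w in \bigcup_n K @^-1` [set n]) (X (K w) w)%:E.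
  congr (integral _ _ _); apply/seteqP; split => // w _.
  by exists (K w).
rewrite ge0_integral_bigcup//; last 3 first.
- by apply/measurable_EFinP; exact: measurable_funTS.
- by move=> w _; rewrite lee_fin.
- by move=> i j _ _ [w [/= -> ->]].
apply: eq_eseriesr => n _; rewrite integral_mkcond.
pose phi (vx : nat * R) : \bar R := (\1_[set n] vx.1 * `|vx.2|)%R%:E.
have mphi : measurable_fun setT phi.
  apply/measurable_EFinP; apply: measurable_funM.
    apply: (@measurableT_comp _ _ _ _ _ _ (\1_[set n] : nat -> R)) => //.
  by apply: measurableT_comp => //; exact: measurable_snd.
have -> : \int[P]_w ((fun w => (X (K w) w)%:E) \_ (K @^-1` [set n])) w =
    \int[P]_w phi (K w, X n w).
  apply: eq_integral => w _; rewrite /phi patchE /= indicE.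
  have [Kn|/eqP Kn] := eqVneq (K w) n.
    by rewrite !mem_set//= mul1r ger0_norm// Kn.
  by rewrite !memNset// mul0r.
rewrite (expectation_independent Fsigma Fmeas indep Ji0 KF (mX n) mphi); last first.
  by move=> vx; rewrite lee_fin mulr_ge0.
transitivity (\int[P]_w ((fine (P (K @^-1` [set n])) * X n w)%R)%:E).
  apply: eq_integral => w _; rewrite /phi /=.
  under eq_integral do rewrite mulrC EFinM.
  rewrite ge0_integralZl_EFin//.
  rewrite integral_indic// setIT ger0_norm// muleC EFinM fineK//.
  exact: fin_num_measure.
rewrite ge0_expectationZ ?fineK ?fine_ge0//; exact: fin_num_measure.
Qed.

End RandomIndex.

(** * The epoch as a recursion *)

Section Averages.
Context {R : realType} {V : lmodType R} {M : nat}.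
Implicit Types a b : 'I_M -> V.

Lemma avgD a b : avg (fun m => a m + b m) = avg a + avg b.
Proof. by rewrite /avg big_split scalerDr. Qed.

Lemma avgN a : avg (fun m => - a m) = - avg a.
Proof. by rewrite /avg sumrN scalerN. Qed.

Lemma avgB a b : avg (fun m => a m - b m) = avg a - avg b.
Proof. by rewrite avgD avgN. Qed.

Lemma avgZ (c : R) a : avg (fun m => c *: a m) = c *: avg a.
Proof. by rewrite /avg -scaler_sumr !scalerA mulrC. Qed.

Lemma avg_cst (v : V) : (0 < M)%N -> avg (fun _ : 'I_M => v) = v.
Proof.
move=> M0; rewrite /avg sumr_const card_ord -[v *+ M]scaler_nat scalerA mulVf ?scale1r//.
by rewrite pnatr_eq0 -lt0n.
Qed.

End Averages.

Lemma powR_threehalves {R : realType} (p : R) : 0 <= p ->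
  (p `^ (3 / 2)) ^+ 2 = p ^+ 3.
Proof.
move=> p0; rewrite -powR_mulrn ?powR_ge0// -powRrM.
by rewrite (_ : 3 / 2 * 2%:R = 3%:R) ?powR_mulrn// divfK.
Qed.

Section Epoch.
Context {R : realType} {d M : nat}.
Variables (M_gt0 : (0 < M)%N) (f : 'I_M -> 'rV[R]_d -> R).
Variables (delta mu p theta : R) (xstar : 'rV[R]_d).
Hypothesis f2 : forall m, twice_differentiable (f m).
Hypothesis delta0 : 0 < delta.
Hypothesis fdelta : delta_related delta f.
Hypothesis mu0 : 0 < mu.
Hypothesis fmu : strongly_convex mu (favg f).
Hypothesis fmin : is_minimizer (favg f) xstar.
Hypothesis p01 : 0 < p < 1.
Hypothesis theta0 : 0 < theta.
Hypothesis theta_le : theta <= p `^ (3 / 2) / (24 * delta).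

Notation server := (Ordinal M_gt0).
Notation f1 := (f server).

Definition server_gap (x : 'rV[R]_d) := grad f1 x - grad (favg f) x.

Lemma fdiff m x : differentiable (f m) x.
Proof. by have [] := f2 m. Qed.

Lemma favg_diff x : differentiable (favg f) x.
Proof. by apply: differentiable_favg => m; exact: fdiff. Qed.

Lemma server_gap_lipschitz a b :
  dotv (server_gap a - server_gap b) (server_gap a - server_gap b)
  <= delta ^+ 2 * dotv (a - b) (a - b).
Proof. exact: (grad_difference_lipschitz f2 (ltW delta0) fdelta). Qed.

Lemma theta_delta_sqr : (theta * delta) ^+ 2 <= p ^+ 3 / 576.
Proof.
have /andP[p0 p1] := p01.
have h : theta * delta <= p `^ (3 / 2) / 24.
  by move: theta_le; rewrite invfM mulrA ler_pdivlMr// .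
have td0 : 0 <= theta * delta by rewrite mulr_ge0 ?ltW.
apply: (@le_trans _ _ ((p `^ (3 / 2) / 24) ^+ 2)).
  by rewrite ler_pXn2r ?nnegrE// divr_ge0 ?powR_ge0.
by rewrite expr_div_n powR_threehalves ?(ltW p0)// -natrX.
Qed.

Lemma theta_delta_small : theta * delta <= 24^-1.
Proof.
have /andP[p0 p1] := p01.
rewrite -(@ler_pXn2r _ 2)// ?nnegrE ?mulr_ge0 ?invr_ge0 ?(ltW theta0) ?(ltW delta0)//.
apply: le_trans theta_delta_sqr _.
have : p ^+ 3 <= 1 by rewrite expr_le1 ?(ltW p0) ?(ltW p1).
have -> : 24^-1 ^+ 2 = 576^-1 :> R by field.
lra.
Qed.

Variables (S : Type) (C : S -> 'rV[R]_d -> 'rV[R]_d).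
Variables (x : 'rV[R]_d) (s : nat -> 'I_M -> S).

Definition epoch_point j := (ef_iter f server C theta x s j).1.
Definition epoch_error j := (ef_iter f server C theta x s j).2.

Definition compressor_input j m := epoch_error j m + theta *:
  (grad (f m) (epoch_point j) - grad f1 (epoch_point j) - grad (f m) x + grad f1 x).

Lemma epoch_errorS j m :
  epoch_error j.+1 m = compressor_input j m - C (s j m) (compressor_input j m).
Proof. by rewrite /epoch_error /= addrAC. Qed.

Lemma epoch_pointS j : epoch_point j.+1 = prox f1 theta (epoch_point j - theta *:
  (theta^-1 *: avg (fun m => C (s j m) (compressor_input j m))
   - grad f1 x + grad (favg f) x)).
Proof. by rewrite {1}/epoch_point /= argmin_proximal_step. Qed.

Lemma avg_gradient_gap y :
  avg (fun m => grad (f m) y - grad f1 y - grad (f m) x + grad f1 x) =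
  server_gap x - server_gap y.
Proof.
rewrite avgD !avgB !avg_cst// -!grad_favg; try by move=> m; exact: fdiff.
rewrite /server_gap; move: (grad _ _) (grad _ _) (grad _ _) (grad _ _) => a b c e.
by apply/rowP => i; rewrite !mxE; ring.
Qed.

(** The errors were defined so that what the compressor drops at one step is
    added back at the next; subtracting their mean from the current point cancels
    the compressed messages altogether. *)
Lemma epoch_recursion j :
  epoch_point j.+1 - avg (epoch_error j.+1) = epoch_point j - avg (epoch_error j)
  - theta *: (grad (favg f) (epoch_point j.+1)
              + (server_gap (epoch_point j.+1) - server_gap (epoch_point j))).
Proof.
have eS : avg (epoch_error j.+1) = avg (epoch_error j)
    + theta *: (server_gap x - server_gap (epoch_point j))
    - avg (fun m => C (s j m) (compressor_input j m)).
  rewrite -avg_gradient_gap -avgZ -avgD -avgB; congr avg.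
  by apply/funext => m; rewrite epoch_errorS.
rewrite {}eS {1}epoch_pointS.
rewrite (proxE (fdiff server) favg_diff delta0 server_gap_lipschitz fmin)//;
  last exact: theta_delta_small.
rewrite -epoch_pointS /server_gap.
move: (avg (fun m => C _ _)) (avg (epoch_error j)) => a e.
move: (epoch_point j.+1) (epoch_point j) => u v.
move: (grad f1 x) (grad (favg f) x) (grad f1 u) (grad (favg f) u) => g1 g2 g3 g4.
move: (grad f1 v) (grad (favg f) v) => g5 g6.
by apply/rowP => i; rewrite !mxE; field; rewrite gt_eqF.
Qed.

(** Young's inequality, with its weight chosen so that the growth [1 + p / 2] per
    step is outweighed by the discount [1 - p] of a geometric length; the price
    is the factor [1 + 2 / p] in front of the gradient part. *)
Lemma compressor_input_bound j m :
  dotv (compressor_input j m) (compressor_input j m) <=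
  (1 + p / 2) * dotv (epoch_error j m) (epoch_error j m)
  + p ^+ 2 * (p + 2) / 144 * dotv (epoch_point j - x) (epoch_point j - x).
Proof.
have /andP[p0 p1] := p01.
rewrite /compressor_input; set gh := _ - _ - _ + _.
have Hm := grad_difference_lipschitz f2 (ltW delta0) fdelta m.
have sm := scaled_lipschitz Hm theta_delta_sqr (epoch_point j) x.
have s1 := scaled_lipschitz server_gap_lipschitz theta_delta_sqr (epoch_point j) x.
have ghE : gh = (grad (f m) (epoch_point j) - grad (favg f) (epoch_point j)
     - (grad (f m) x - grad (favg f) x))
   - (server_gap (epoch_point j) - server_gap x).
  rewrite /gh /server_gap.
  move: (grad (f m) x) (grad (favg f) x) (grad f1 x) => a b c.
  move: (grad (f m) _) (grad (favg f) _) (grad f1 _) => a' b' c'.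
  by apply/rowP => i; rewrite !mxE; ring.
have gsmall : theta ^+ 2 * dotv gh gh <=
    p ^+ 3 / 144 * dotv (epoch_point j - x) (epoch_point j - x).
  rewrite ghE; set A := _ - (_ - _) in sm *; set B := server_gap _ - _ in s1 *.
  have := ler_wpM2l (sqr_ge0 theta) (sqnormB2 A B).
  move/le_trans; apply; move: sm s1.
  move: (theta ^+ 2) (dotv A A) (dotv B B) (p ^+ 3) => t a b q.
  by move: (dotv _ _) => U *; lra.
have p2 : 0 < p / 2 by rewrite divr_gt0.
have := youngv (epoch_error j m) (theta *: gh) p2.
rewrite (dotvvD (epoch_error j m)) dotvvZ.
have : (p / 2)^-1 * (theta ^+ 2 * dotv gh gh) <=
    (p / 2)^-1 * (p ^+ 3 / 144 * dotv (epoch_point j - x) (epoch_point j - x)).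
  by rewrite ler_wpM2l// invr_ge0 ltW.
have -> : (p / 2)^-1 * (p ^+ 3 / 144 * dotv (epoch_point j - x) (epoch_point j - x)) =
    p ^+ 2 / 72 * dotv (epoch_point j - x) (epoch_point j - x).
  by field; rewrite gt_eqF.
move: gsmall; set U := dotv (epoch_point j - x) _.
have -> : p ^+ 2 * (p + 2) / 144 * U = p ^+ 3 / 144 * U + p ^+ 2 / 72 * U by field.
move: (theta ^+ 2 * _) (p ^+ 3 / 144 * U) (p ^+ 2 / 72 * U) => a b c.
move: (_^-1 * a) (dotv (epoch_error _ _) _) (dotv _ (theta *: _)) => e' ee eg.
by clear Hm sm s1 ghE theta_le; lra.
Qed.

End Epoch.

(** * Randomness of the algorithm *)

Section RandomEpochs.
Context {R : realType} {d M : nat}.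
Variables (M_gt0 : (0 < M)%N) (f : 'I_M -> 'rV[R]_d -> R).
Variables (delta mu p theta tau alpha beta : R) (xstar y0 : 'rV[R]_d).
Hypothesis f2 : forall m, twice_differentiable (f m).
Hypothesis delta0 : 0 < delta.
Hypothesis fdelta : delta_related delta f.
Hypothesis mu0 : 0 < mu.
Hypothesis fmu : strongly_convex mu (favg f).
Hypothesis fmin : is_minimizer (favg f) xstar.
Hypothesis p01 : 0 < p < 1.
Hypothesis theta0 : 0 < theta.
Hypothesis theta_le : theta <= p `^ (3 / 2) / (24 * delta).
Hypothesis tau01 : 0 < tau < 1.
Hypothesis alpha0 : 0 < alpha.
Hypothesis small : 28 * alpha * p * tau <= theta.
Context {dS : measure_display} {S : measurableType dS}.
Variables (Q : probability S R) (C : S -> 'rV[R]_d -> 'rV[R]_d).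
Hypothesis beta1 : 1 < beta.
Hypothesis compressor : biased_compressor Q beta C.
Context {dO : measure_display} {Omega : measurableType dO}.
Variables (P : probability Omega R).
Variables (N : nat -> {RV P >-> nat}) (xi : nat -> nat -> 'I_M -> {RV P >-> S}).
Hypothesis randomness : olga_randomness Q p N xi.

Let label := (nat + nat * nat * 'I_M)%type.

(** Independent variables: epoch lengths on the left, compressor seeds on the
    right. *)
Definition source (i : label) : set (set Omega) :=
  match i with
  | inl k => g_sigma_algebra_preimage (N k)
  | inr (k, j, m) => g_sigma_algebra_preimage (xi k j m)
  end.

(** The variables that determine the [j]-th inner point of epoch [k]. *)
Definition seen k j : set label := [set i | match i with
  | inl a => (a < k)%N
  | inr (a, b, _) => (a < k)%N || (a == k) && (b < j)%N
  end].

Lemma source_sigma i : sigma_algebra setT (source i).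
Proof.
case: i => [k|[[k j] m]];
  exact: (@sigma_algebra_measurable _ (g_sigma_algebra_preimageType _)).
Qed.

Lemma source_measurable i : source i `<=` measurable.
Proof.
by case: i => [k|[[k j] m]] _ [B mB <-]; exact: measurable_funP.
Qed.

Lemma source_independent : mutually_independent P source.
Proof. by have [_ _] := randomness. Qed.

Lemma seenS k j : seen k j `<=` seen k j.+1.
Proof.
move=> [a|[[a b] m]] //= /orP[->//|/andP[-> bj]].
by rewrite (ltn_trans bj) ?orbT.
Qed.

Lemma seen0 k j : seen k 0 `<=` seen k j.
Proof. by elim: j => // j IH i /IH; exact: seenS. Qed.

Lemma seen_next k j : seen k j `<=` seen k.+1 0.
Proof.
move=> [a|[[a b] m]] /=; first by move/leq_trans; apply.
by case/orP => [ak|/andP[/eqP -> _]]; rewrite ltnS ?leqnn// ltnW.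
Qed.

Lemma seen_length k : seen k.+1 0 (inl k).
Proof. exact: ltnSn. Qed.

Lemma seen_seed k j m : seen k j.+1 (inr (k, j, m)).
Proof. by rewrite /seen /= eqxx ltnSn orbT. Qed.

Lemma unseen_seed k j m : ~ seen k j (inr (k, j, m)).
Proof. by rewrite /seen /= !ltnn andbF. Qed.

Notation known J := (g_sigma_algebraType (history source J)).
Notation vec_known J X := (@measurable_vec R d _ (known J) X).

Lemma vec_known_mono J J' (X : Omega -> 'rV[R]_d) : J `<=` J' ->
  vec_known J X -> vec_known J' X.
Proof. exact: measurable_history_mono. Qed.

Lemma vec_known_measurable J (X : Omega -> 'rV[R]_d) : vec_known J X ->
  measurable_vec X.
Proof. exact: (measurable_history source_measurable). Qed.

Lemma compressed_known k j m (Y : Omega -> 'rV[R]_d) : vec_known (seen k j) Y ->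
  vec_known (seen k j.+1) (fun w => C (xi k j m w) (Y w)).
Proof.
move=> mY; have [mC _] := compressor.
have mxi : @measurable_fun _ _ (known (seen k j.+1)) S setT (xi k j m).
  exact: (measurable_known (seen_seed k j m)).
have mY' := vec_known_mono (@seenS k j) mY.
exact: measurableT_comp mC (measurable_fun_pair mxi mY').
Qed.

Lemma grad_continuous m : continuous (grad (f m)).
Proof. by move=> x; apply: differentiable_continuous; have [] := f2 m. Qed.

Lemma favg_grad_continuous : continuous (grad (favg f)).
Proof.
by move=> x; apply: differentiable_continuous; exact: differentiable_grad_favg.
Qed.

Lemma server_gap_continuous : continuous (server_gap M_gt0 f).
Proof.
move=> x; apply: differentiable_continuous; apply: differentiableB.
  by have [] := f2 (Ordinal M_gt0).
exact: differentiable_grad_favg.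
Qed.

Lemma favg_continuous : continuous (favg f).
Proof. by move=> x; apply: differentiable_continuous; exact: favg_diff. Qed.

Definition outer_state k (w : Omega) := ef_olga f (Ordinal M_gt0) C p theta mu tau alpha
  y0 (fun k => N k w) (fun k j m => xi k j m w) k.

Definition extrapolation k w := tau *: (outer_state k w).2 + (1 - tau) *: (outer_state k w).1.

Definition inner_point k j w := epoch_point M_gt0 f theta C (extrapolation k w) (fun j m => xi k j m w) j.

Definition local_error k j m w :=
  epoch_error M_gt0 f theta C (extrapolation k w) (fun j m => xi k j m w) j m.

Definition node_input k j m w :=
  compressor_input M_gt0 f theta C (extrapolation k w) (fun j m => xi k j m w) j m.

(** The point [z] that the outer step would output if epoch [k] had length
    [n]. *)
Definition mirror_point k n w := (alpha^-1 + mu)^-1 *: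
  (alpha^-1 *: (outer_state k w).2 + mu *: inner_point k n w -
   p *: ((server_gap M_gt0 f (extrapolation k w) - server_gap M_gt0 f (inner_point k n w))
         + theta^-1 *: (extrapolation k w - (inner_point k n w - avg (fun m => local_error k n m w))))).

Lemma outer_stateS k w : outer_state k.+1 w = (inner_point k (N k w) w, mirror_point k (N k w) w).
Proof.
rewrite /outer_state /= -/(outer_state k w) /olga_step /EFEpoch /= argmin_quadratic//.
rewrite !gradB; try exact: fdiff; try exact: favg_diff.
by [].
Qed.

Lemma epoch_known k : vec_known (seen k 0) (fun w => (outer_state k w).1) ->
  vec_known (seen k 0) (fun w => (outer_state k w).2) ->
  forall j, [/\ vec_known (seen k j) (inner_point k j),
    forall m, vec_known (seen k j) (local_error k j m) &
    forall m, vec_known (seen k j) (node_input k j m)].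
Proof.
move=> my mz.
have mx : vec_known (seen k 0) (extrapolation k).
  by apply: measurable_vecD; exact: measurable_vecZ.
have minput j : vec_known (seen k j) (inner_point k j) ->
    (forall m, vec_known (seen k j) (local_error k j m)) ->
    forall m, vec_known (seen k j) (node_input k j m).
  move=> mu_ meps m; have mxj := vec_known_mono (@seen0 k j) mx.
  apply: measurable_vecD; first exact: meps.
  apply: measurable_vecZ; apply: measurable_vecD; last first.
    exact: measurable_vec_comp (@grad_continuous _) mxj.
  apply: measurable_vecB; last exact: measurable_vec_comp (@grad_continuous _) mxj.
  by apply: measurable_vecB;
    exact: measurable_vec_comp (@grad_continuous _) mu_.
elim=> [|j [mu_ meps minp]].
  have mu_ : vec_known (seen k 0) (inner_point k 0) by exact: mx.
  have meps m : vec_known (seen k 0) (local_error k 0 m) by exact: measurable_vec_cst.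
  by split; [exact: mu_|exact: meps|exact: minput].
have mC m := compressed_known m (minp m).
have meps' m : vec_known (seen k j.+1) (local_error k j.+1 m).
  have -> : local_error k j.+1 m = fun w => node_input k j m w - C (xi k j m w) (node_input k j m w).
    by apply/funext => w; rewrite /local_error epoch_errorS.
  by apply: measurable_vecB => //; exact: vec_known_mono (@seenS k j) _.
have mxj := vec_known_mono (@seen0 k j.+1) mx.
have mu' : vec_known (seen k j.+1) (inner_point k j.+1).
  have -> : inner_point k j.+1 = prox (f (Ordinal M_gt0)) theta \o
     (fun w => inner_point k j w - theta *: (theta^-1 *:
        avg (fun m => C (xi k j m w) (node_input k j m w))
        - grad (f (Ordinal M_gt0)) (extrapolation k w) + grad (favg f) (extrapolation k w))).
    by apply/funext => w; rewrite /inner_point epoch_pointS.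
  apply: measurable_vec_comp.
    apply: (@continuous_prox _ _ _ (favg f) delta mu theta xstar) => //.
    - exact: fdiff.
    - exact: favg_diff.
    - exact: server_gap_lipschitz.
    - exact: (@theta_delta_small _ delta p theta).
  apply: measurable_vecB; first exact: vec_known_mono (@seenS k j) _.
  apply: measurable_vecZ; apply: measurable_vecD; last first.
    exact: measurable_vec_comp favg_grad_continuous mxj.
  apply: measurable_vecB; last exact: measurable_vec_comp (@grad_continuous _) mxj.
  by apply: measurable_vecZ; exact: measurable_vec_avg.
by split; [exact: mu'|exact: meps'|exact: minput].
Qed.

Lemma mirror_point_known k : vec_known (seen k 0) (fun w => (outer_state k w).1) ->
  vec_known (seen k 0) (fun w => (outer_state k w).2) ->
  forall n, vec_known (seen k n) (mirror_point k n).
Proof.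
move=> my mz n; have [mu_ meps _] := epoch_known my mz n.
have mx : vec_known (seen k n) (extrapolation k).
  by apply: (vec_known_mono (@seen0 k n)); apply: measurable_vecD;
    exact: measurable_vecZ.
apply: measurable_vecZ; apply: measurable_vecB.
  apply: measurable_vecD; apply: measurable_vecZ => //.
  exact: vec_known_mono (@seen0 k n) mz.
apply: measurable_vecZ; apply: measurable_vecD.
  by apply: measurable_vecB; exact: measurable_vec_comp server_gap_continuous _.
apply: measurable_vecZ; apply: measurable_vecB => //; apply: measurable_vecB => //.
exact: measurable_vec_avg.
Qed.

Lemma outer_state_known k : vec_known (seen k 0) (fun w => (outer_state k w).1) /\
  vec_known (seen k 0) (fun w => (outer_state k w).2).
Proof.
elim: k => [|k [my mz]].
  by split; exact: measurable_vec_cst.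
have mN : @measurable_fun _ _ (known (seen k.+1 0)) nat setT (N k).
  exact: (measurable_known (seen_length k)).
split.
- have -> : (fun w => (outer_state k.+1 w).1) = fun w => inner_point k (N k w) w.
    by apply/funext => w; rewrite outer_stateS.
  apply: measurable_random_index => // n.
  by apply: (vec_known_mono (@seen_next k n)); have [] := epoch_known my mz n.
- have -> : (fun w => (outer_state k.+1 w).2) = fun w => mirror_point k (N k w) w.
    by apply/funext => w; rewrite outer_stateS.
  apply: measurable_random_index => // n.
  by apply: (vec_known_mono (@seen_next k n)); exact: mirror_point_known.
Qed.

Lemma inner_point_known k j : vec_known (seen k j) (inner_point k j).
Proof. by have [my mz] := outer_state_known k; have [] := epoch_known my mz j. Qed.

Lemma local_error_known k j m : vec_known (seen k j) (local_error k j m).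
Proof. by have [my mz] := outer_state_known k; have [] := epoch_known my mz j. Qed.

Lemma node_input_known k j m : vec_known (seen k j) (node_input k j m).
Proof. by have [my mz] := outer_state_known k; have [] := epoch_known my mz j. Qed.

Lemma extrapolation_measurable k : measurable_vec (extrapolation k).
Proof.
have h : measurable_vec (inner_point k 0) := vec_known_measurable (@inner_point_known k 0).
exact: h.
Qed.

Local Open Scope ereal_scope.

(** The seed is independent of the vector it compresses, so the compressor bound
    holds conditionally on that vector; [1 - 1 / beta] is estimated by [1]. *)
Lemma compression_error_le k j m :
  \int[P]_w (dotv (local_error k j.+1 m w) (local_error k j.+1 m w))%:E <=
  \int[P]_w (dotv (node_input k j m w) (node_input k j m w))%:E.
Proof.
have [mC Cbeta] := compressor; have [_ xiQ _] := randomness.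
pose phi (sy : S * borelRV R d) : \bar R :=
  (dotv (sy.2 - C sy.1 sy.2) (sy.2 - C sy.1 sy.2))%R%:E.
have mphi : measurable_fun setT phi.
  apply/measurable_EFinP; apply: measurable_sqnorm; apply: measurable_vecB => //.
  exact: measurable_snd.
have -> : \int[P]_w (dotv (local_error k j.+1 m w) (local_error k j.+1 m w))%:E =
    \int[P]_w phi (xi k j m w, node_input k j m w).
  by apply: eq_integral => w _; rewrite /local_error epoch_errorS.
rewrite (expectation_independent source_sigma source_measurable source_independent
  (@unseen_seed k j m) _ (@node_input_known k j m) mphi) //; last first.
  by move=> sy; rewrite lee_fin dotvv_ge0.
have mX := vec_known_measurable (@node_input_known k j m).
apply: ge0_le_integral => //.
- move=> w _; apply: integral_ge0 => v _; by rewrite lee_fin dotvv_ge0.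
- apply: (@measurableT_comp _ _ _ _ _ _
    (fun y : borelRV R d => \int[distribution P (xi k j m)]_v phi (v, y))) => //.
  apply: (@measurable_fun_fubini_tonelli_G _ _ S (borelRV R d) R) => //.
  by move=> sy; rewrite lee_fin dotvv_ge0.
- by apply/measurable_EFinP; exact: measurable_sqnorm.
move=> w _; rewrite (@eq_measure_integral _ _ _ _ Q); last first.
  by move=> A mA _; exact: xiQ.
have := Cbeta (node_input k j m w); rewrite unlock.
have -> : \int[Q]_v phi (v, node_input k j m w) =
    \int[Q]_v (enorm (C v (node_input k j m w) - node_input k j m w) ^+ 2)%:E.
  by apply: eq_integral => v _; rewrite /phi /= enorm_sqr dotvvBC.
move/le_trans; apply; rewrite lee_fin enorm_sqr ler_piMl ?dotvv_ge0//.
by rewrite gerBl invr_ge0 ltW// (lt_trans _ beta1).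
Qed.

Definition mean_sq_error k j w :=
  (\sum_(m < M) M%:R^-1 * dotv (local_error k j m w) (local_error k j m w))%R.

Lemma mean_sq_error_ge0 k j w : (0 <= mean_sq_error k j w)%R.
Proof. by apply: sumr_ge0 => m _; rewrite mulr_ge0 ?invr_ge0 ?dotvv_ge0. Qed.

Lemma mean_sq_error0 k w : mean_sq_error k 0 w = 0%R.
Proof.
by rewrite /mean_sq_error big1// => m _; rewrite [local_error _ _ _ _]/(0%R) dotv0l mulr0.
Qed.

Lemma sqnorm_avg_eps k j w :
  (dotv (avg (fun m => local_error k j m w)) (avg (fun m => local_error k j m w))
   <= mean_sq_error k j w)%R.
Proof.
by apply: le_trans (sqnorm_avg _ M_gt0) _; rewrite /avg /mean_sq_error -mulr_sumr.
Qed.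

Lemma measurable_eps_sqnorm k j m :
  measurable_fun setT (fun w => dotv (local_error k j m w) (local_error k j m w)).
Proof. exact: measurable_sqnorm (vec_known_measurable (@local_error_known k j m)). Qed.

Lemma measurable_mean_sq_error k j : measurable_fun setT (mean_sq_error k j).
Proof.
by apply: measurable_sum => m; apply: measurable_funM => //;
  exact: measurable_eps_sqnorm.
Qed.

Lemma measurable_displacement k j :
  measurable_fun setT (fun w => dotv (inner_point k j w - extrapolation k w) (inner_point k j w - extrapolation k w)).
Proof.
apply: measurable_sqnorm; apply: measurable_vecB; last exact: extrapolation_measurable.
exact: vec_known_measurable (@inner_point_known k j).
Qed.

Lemma measurable_distance k j :
  measurable_fun setT (fun w => dotv (inner_point k j w - xstar) (inner_point k j w - xstar)).
Proof.
apply: measurable_sqnorm; apply: measurable_vecB; last exact: measurable_vec_cst.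
exact: vec_known_measurable (@inner_point_known k j).
Qed.

Lemma mean_sq_error_step k j :
  \int[P]_w (mean_sq_error k j.+1 w)%:E <=
  (1 + p / 2)%:E * \int[P]_w (mean_sq_error k j w)%:E +
  (p ^+ 2 * (p + 2) / 144)%:E *
    \int[P]_w (dotv (inner_point k j w - extrapolation k w) (inner_point k j w - extrapolation k w))%:E.
Proof.
have /andP[p0 p1] := p01.
have Mi : (0 <= M%:R^-1 :> R)%R by rewrite invr_ge0.
have c0 : (0 <= p ^+ 2 * (p + 2) / 144)%R.
  by rewrite divr_ge0// mulr_ge0 ?sqr_ge0//; lra.
have c1 : (0 <= 1 + p / 2)%R by lra.
have minp m : measurable_fun setT (fun w => dotv (node_input k j m w) (node_input k j m w)).
  exact: measurable_sqnorm (vec_known_measurable (@node_input_known k j m)).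
apply: (@le_trans _ _ (\int[P]_w (\sum_(m < M)
    M%:R^-1 * dotv (node_input k j m w) (node_input k j m w))%R%:E)).
  rewrite !ge0_expectation_sum//; last 3 first.
  - by move=> m w; exact: dotvv_ge0.
  - exact: measurable_eps_sqnorm.
  - by move=> m w; exact: dotvv_ge0.
  apply: lee_sum => m _; apply: lee_wpmul2l; first by rewrite lee_fin.
  exact: compression_error_le.
rewrite -!ge0_expectationZ//; last first.
- by move=> w; exact: mean_sq_error_ge0.
- exact: measurable_mean_sq_error.
- by move=> w; exact: dotvv_ge0.
- exact: measurable_displacement.
rewrite -ge0_expectationD; last first.
- by move=> w; rewrite mulr_ge0// dotvv_ge0.
- by move=> w; rewrite mulr_ge0// mean_sq_error_ge0.
- by apply: measurable_funM => //; exact: measurable_displacement.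
- by apply: measurable_funM => //; exact: measurable_mean_sq_error.
apply: ge0_expectation_le.
- by apply: measurable_sum => m; apply: measurable_funM.
- apply: measurable_funD; apply: measurable_funM => //.
    exact: measurable_mean_sq_error.
  exact: measurable_displacement.
- by move=> w; apply: sumr_ge0 => m _; rewrite mulr_ge0// dotvv_ge0.
move=> w; apply: (@le_trans _ _ (\sum_(m < M) M%:R^-1 *
   ((1 + p / 2) * dotv (local_error k j m w) (local_error k j m w) +
    p ^+ 2 * (p + 2) / 144 * dotv (inner_point k j w - extrapolation k w) (inner_point k j w - extrapolation k w)))%R).
  apply: ler_sum => m _; apply: ler_wpM2l => //.
  exact: (compressor_input_bound _ f2 delta0 fdelta p01 theta0 theta_le).
rewrite le_eqVlt; apply/orP; left; apply/eqP.
under eq_bigr do rewrite mulrDr (mulrCA _ (1 + p / 2)%R).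
rewrite big_split /=; congr (_ + _)%R; first by rewrite /mean_sq_error mulr_sumr.
move: (dotv _ _) => D; rewrite sumr_const card_ord -[LHS]mulr_natl mulrA.
by rewrite divff ?mul1r// pnatr_eq0 -lt0n.
Qed.

Definition distance_sq (v : Omega -> 'rV[R]_d) :=
  \int[P]_w (dotv (v w - xstar) (v w - xstar))%:E.

Lemma second_moments_finite k :
  distance_sq (fun w => (outer_state k w).1) < +oo ->
  distance_sq (fun w => (outer_state k w).2) < +oo ->
  forall j, [/\ distance_sq (inner_point k j) < +oo,
    \int[P]_w (dotv (inner_point k j w - extrapolation k w) (inner_point k j w - extrapolation k w))%:E < +oo
    & \int[P]_w (mean_sq_error k j w)%:E < +oo].
Proof.
move=> fy fz; have /andP[p0 p1] := p01.
have [my mz] := outer_state_known k.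
have {}my := measurable_sqnorm (measurable_vecB (vec_known_measurable my)
  (measurable_vec_cst xstar)).
have {}mz := measurable_sqnorm (measurable_vecB (vec_known_measurable mz)
  (measurable_vec_cst xstar)).
have lin (a : R) (A B : Omega -> R) (X : Omega -> R) : measurable_fun setT X ->
    measurable_fun setT A -> measurable_fun setT B ->
    (forall w, 0 <= X w)%R -> (forall w, 0 <= A w)%R -> (forall w, 0 <= B w)%R ->
    (0 <= a)%R -> (forall w, X w <= a * (A w + B w))%R ->
    \int[P]_w (A w)%:E < +oo -> \int[P]_w (B w)%:E < +oo ->
    \int[P]_w (X w)%:E < +oo.
  move=> mX mA mB X0 A0 B0 a0 XAB fA fB.
  apply: (@le_lt_trans _ _ (\int[P]_w (a * (A w + B w))%:E)).
    apply: ge0_expectation_le => //; apply: measurable_funM => //.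
    exact: measurable_funD.
  rewrite ge0_expectationZ//; last 2 first.
  - exact: measurable_funD.
  - by move=> w; rewrite addr_ge0.
  by rewrite ge0_expectationD// lte_mul_pinfty// lte_add_pinfty.
have fx : distance_sq (extrapolation k) < +oo.
  rewrite /distance_sq; apply: (lin 2%R _ _ _ _ my mz _ _ _ _ _ fy fz).
  - exact: (measurable_distance k 0).
  - by move=> w; exact: dotvv_ge0.
  - by move=> w; exact: dotvv_ge0.
  - by move=> w; exact: dotvv_ge0.
  - by [].
  move=> w; have /andP[t0 t1] := tau01.
  have -> : (extrapolation k w - xstar = tau *: ((outer_state k w).2 - xstar)
      + (1 - tau) *: ((outer_state k w).1 - xstar))%R.
    rewrite /extrapolation; move: (outer_state k w).2 (outer_state k w).1 => a b.
    by apply/rowP => i; rewrite !mxE; ring.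
  apply: le_trans (sqnormD2 _ _) _; rewrite !dotvvZ.
  have := dotvv_ge0 ((outer_state k w).2 - xstar).
  have := dotvv_ge0 ((outer_state k w).1 - xstar).
  move: (dotv ((outer_state k w).1 - _) _) (dotv ((outer_state k w).2 - _) _) => a b a0 b0.
  have : (tau ^+ 2 * b <= b)%R by rewrite ler_piMl// expr_le1// ltW.
  have : ((1 - tau) ^+ 2 * a <= a)%R by rewrite ler_piMl// expr_le1//; lra.
  lra.
have disp j : distance_sq (inner_point k j) < +oo ->
    \int[P]_w (dotv (inner_point k j w - extrapolation k w) (inner_point k j w - extrapolation k w))%:E < +oo.
  move=> fu.
  apply: (lin 2%R _ _ _ _ (measurable_distance k j) (measurable_distance k 0)
    _ _ _ _ _ fu fx).
  - exact: measurable_displacement.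
  - by move=> w; exact: dotvv_ge0.
  - by move=> w; exact: dotvv_ge0.
  - by move=> w; exact: dotvv_ge0.
  - by [].
  move=> w; have := sqnormB2 (inner_point k j w - xstar) (extrapolation k w - xstar).
  by rewrite opprB addrA subrK mulrDr.
elim=> [|j [fu fd fe]].
  split; first exact: fx.
    by apply: disp; exact: fx.
  by under eq_integral do rewrite mean_sq_error0; rewrite integral0.
have fe' : \int[P]_w (mean_sq_error k j.+1 w)%:E < +oo.
  apply: le_lt_trans (mean_sq_error_step k j) _.
  by rewrite lte_add_pinfty// lte_mul_pinfty// lee_fin; nra.
have fu' : distance_sq (inner_point k j.+1) < +oo.
  rewrite /distance_sq.
  apply: (lin 12%R _ (fun w => (mean_sq_error k j w + mean_sq_error k j.+1 w)%R) _ _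
      (measurable_distance k j) _ _ _ _ _ _ fu).
  - exact: measurable_distance.
  - by apply: measurable_funD; exact: measurable_mean_sq_error.
  - by move=> w; exact: dotvv_ge0.
  - by move=> w; exact: dotvv_ge0.
  - by move=> w; rewrite addr_ge0 ?mean_sq_error_ge0.
  - by [].
  - move=> w; have := iterate_growth (server_gap_lipschitz M_gt0 f2 delta0 fdelta) mu0
      fmu fmin p01 theta0 (theta_delta_sqr delta0 p01 theta0 theta_le)
      (epoch_recursion M_gt0 f2 delta0 fdelta fmin p01 theta0 theta_le C
         (extrapolation k w) (fun j m => xi k j m w) j).
    have := sqnorm_avg_eps k j w; have := sqnorm_avg_eps k j.+1 w.
    rewrite -/(inner_point k j w) -/(inner_point k j.+1 w); move: (dotv (inner_point k j w - _) _) => a.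
    rewrite /local_error; lra.
  rewrite ge0_expectationD; last 4 first.
  - exact: measurable_mean_sq_error.
  - exact: measurable_mean_sq_error.
  - by move=> w; exact: mean_sq_error_ge0.
  - by move=> w; exact: mean_sq_error_ge0.
  exact: lte_add_pinfty fe fe'.
by split; [exact: fu'|exact: disp|exact: fe'].
Qed.

(** The Lyapunov function after the outer step, had epoch [k] length [n]. *)
Definition potential k n w :=
  (alpha / tau * (favg f (inner_point k n w) - favg f xstar)
   + (1 + mu * alpha) / 2 * dotv (mirror_point k n w - xstar) (mirror_point k n w - xstar))%R.

Definition budget k w :=
  ((1 - tau) * (alpha / tau * (favg f (outer_state k w).1 - favg f xstar))
   + 2^-1 * dotv ((outer_state k w).2 - xstar) ((outer_state k w).2 - xstar))%R.

Lemma potential_ge0 k n w : (0 <= potential k n w)%R.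
Proof.
have /andP[t0 t1] := tau01.
apply: addr_ge0; apply: mulr_ge0; rewrite ?dotvv_ge0 ?subr_ge0//.
  by rewrite divr_ge0 ?ltW.
by rewrite divr_ge0// addr_ge0// mulr_ge0 ?ltW.
Qed.

Lemma budget_ge0 k w : (0 <= budget k w)%R.
Proof.
have /andP[t0 t1] := tau01.
apply: addr_ge0; last by rewrite mulr_ge0 ?dotvv_ge0 ?invr_ge0.
apply: mulr_ge0; first by lra.
by apply: mulr_ge0; rewrite ?subr_ge0// divr_ge0 ?ltW.
Qed.

(** All variables of the first [k] epochs and all seeds of epoch [k], but not
    the length of epoch [k]. *)
Definition seen_seeds k : set label := [set i | match i with
  | inl a => (a < k)%N
  | inr (a, b, _) => (a <= k)%N
  end].

Lemma seen_seedsP k j : seen k j `<=` seen_seeds k.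
Proof.
by move=> [a|[[a b] m]] //= /orP[/ltnW|/andP[/eqP -> _]].
Qed.

Lemma unseen_length_seeds k : ~ seen_seeds k (inl k).
Proof. by rewrite /seen_seeds /= ltnn. Qed.

Lemma potential_known k n :
  @measurable_fun _ _ (known (seen_seeds k)) R setT (potential k n).
Proof.
have mu_ := vec_known_mono (@seen_seedsP k n) (@inner_point_known k n).
have [my mz] := outer_state_known k.
have mm := vec_known_mono (@seen_seedsP k n) (@mirror_point_known k my mz n).
apply: measurable_funD; apply: measurable_funM => //.
  apply: measurable_funB => //.
  exact: measurable_real_comp favg_continuous mu_.
by apply: measurable_sqnorm; apply: measurable_vecB => //; exact: measurable_vec_cst.
Qed.

Lemma potential_measurable k n : measurable_fun setT (potential k n).
Proof. exact: (measurable_history source_measurable (@potential_known k n)). Qed.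

Lemma measurable_mirror_distance k : measurable_fun setT
  (fun w => dotv ((outer_state k w).2 - xstar) ((outer_state k w).2 - xstar)).
Proof.
have [_ mz] := outer_state_known k.
exact: (measurable_sqnorm (measurable_vecB (vec_known_measurable mz)
  (measurable_vec_cst xstar))).
Qed.

Lemma measurable_state_value k : measurable_fun setT
  (fun w => favg f (outer_state k w).1 - favg f xstar)%R.
Proof.
have [my _] := outer_state_known k; apply: measurable_funB => //.
exact: measurable_real_comp favg_continuous (vec_known_measurable my).
Qed.

Lemma budget_measurable k : measurable_fun setT (budget k).
Proof.
apply: measurable_funD; apply: measurable_funM => //.
  by apply: measurable_funM => //; exact: measurable_state_value.
exact: measurable_mirror_distance.
Qed.

(** Integrating the pathwise inequality: the errors on the right are bounded in
    mean by the displacements on the left, which are finite and cancel. *)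
Lemma truncated_epoch_bound k K :
  distance_sq (fun w => (outer_state k w).1) < +oo ->
  distance_sq (fun w => (outer_state k w).2) < +oo ->
  \sum_(n < K.+1) (p * (1 - p) ^+ n)%:E * \int[P]_w (potential k n.+1 w)%:E <=
  \int[P]_w (budget k w)%:E +
  (14 * alpha * tau / theta * (1 - p) ^+ K)%:E * distance_sq (fun w => (outer_state k w).2).
Proof.
move=> fy fz; have moments := second_moments_finite fy fz.
have /andP[p0 p1] := p01; have /andP[t0 t1] := tau01.
have w0 n := geometric_weight_ge0 n p01.
pose disp n w := dotv (inner_point k n w - extrapolation k w) (inner_point k n w - extrapolation k w).
pose zdist w := dotv ((outer_state k w).2 - xstar) ((outer_state k w).2 - xstar).
pose kap := (alpha / (2 * theta * tau))%R.
pose c := (14 * alpha * tau / theta * (1 - p) ^+ K)%R.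
have kap0 : (0 < kap)%R by rewrite divr_gt0// !mulr_gt0.
have c0 : (0 <= c)%R.
  by rewrite mulr_ge0 ?exprn_ge0 ?divr_ge0 ?mulr_ge0 ?ltW//; lra.
have fin_disp n : \int[P]_w (disp n w)%:E \is a fin_num.
  rewrite ge0_fin_numE; first by have [] := moments n.
  by apply: integral_ge0 => w _; rewrite lee_fin dotvv_ge0.
have fin_mse n : \int[P]_w (mean_sq_error k n w)%:E \is a fin_num.
  rewrite ge0_fin_numE; first by have [] := moments n.
  by apply: integral_ge0 => w _; rewrite lee_fin mean_sq_error_ge0.
pose a n := fine (\int[P]_w (disp n w)%:E).
pose s n := fine (\int[P]_w (mean_sq_error k n w)%:E).
have aE n : \int[P]_w (disp n w)%:E = (a n)%:E by rewrite fineK.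
have sE n : \int[P]_w (mean_sq_error k n w)%:E = (s n)%:E by rewrite fineK.
have errors : (\sum_(n < K.+1) p * (1 - p) ^+ n * s n.+1 <=
    p / 36 * \sum_(n < K.+1) p * (1 - p) ^+ n * a n.+1)%R.
  apply: weighted_error_bound => //.
  - rewrite /a /disp [inner_point k 0]/(extrapolation k).
    by under eq_integral do rewrite subrr dotv0l; rewrite integral0.
  - by rewrite /s; under eq_integral do rewrite mean_sq_error0; rewrite integral0.
  - by move=> n; rewrite fine_ge0// integral_ge0// => w _; rewrite lee_fin dotvv_ge0.
  - move=> n; rewrite fine_ge0// integral_ge0// => w _.
    by rewrite lee_fin mean_sq_error_ge0.
  move=> n; have := mean_sq_error_step k n.
  by rewrite -/(disp n _) !sE aE -!EFinM -EFinD lee_fin.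
pose X1 w := (\sum_(n < K.+1) p * (1 - p) ^+ n * potential k n.+1 w)%R.
pose X2 w := (\sum_(n < K.+1) p * (1 - p) ^+ n * disp n.+1 w)%R.
pose X3 w := (\sum_(n < K.+1) p * (1 - p) ^+ n * mean_sq_error k n.+1 w)%R.
have mX1 : measurable_fun setT X1.
  by apply: measurable_sum => n; apply: measurable_funM => //; exact: potential_measurable.
have mX2 : measurable_fun setT X2.
  by apply: measurable_sum => n; apply: measurable_funM => //; exact: measurable_displacement.
have mX3 : measurable_fun setT X3.
  by apply: measurable_sum => n; apply: measurable_funM => //; exact: measurable_mean_sq_error.
have X10 w : (0 <= X1 w)%R.
  by apply: sumr_ge0 => n _; rewrite mulr_ge0// potential_ge0.
have X20 w : (0 <= X2 w)%R by apply: sumr_ge0 => n _; rewrite mulr_ge0// dotvv_ge0.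
have X30 w : (0 <= X3 w)%R.
  by apply: sumr_ge0 => n _; rewrite mulr_ge0// mean_sq_error_ge0.
have k6 : (0 <= kap * (p / 6))%R by rewrite ltW// mulr_gt0// divr_gt0.
have k7 : (0 <= kap * 6)%R by rewrite ltW// mulr_gt0.
have mz : measurable_fun setT zdist := measurable_mirror_distance k.
have z0 w : (0 <= zdist w)%R := dotvv_ge0 _.
have pathwise w : (X1 w + kap * (p / 6) * X2 w <=
    (budget k w + c * zdist w) + kap * 6 * X3 w)%R.
  have e0 : (avg (fun m => local_error k 0 m w) = 0)%R by exact: avg_cst.
  have rec n := epoch_recursion M_gt0 f2 delta0 fdelta fmin p01 theta0 theta_le C
         (extrapolation k w) (fun j m => xi k j m w) n.
  have := @outer_step_pathwise R d (favg f) (server_gap M_gt0 f) delta mu theta p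
    xstar (server_gap_lipschitz M_gt0 f2 delta0 fdelta) mu0 fmu fmin p01 theta0
    (theta_delta_sqr delta0 p01 theta0 theta_le) tau alpha (extrapolation k w)
    (outer_state k w).1 (outer_state k w).2 (fun n => inner_point k n w)
    (fun n => avg (fun m => local_error k n m w)) (fun n => mirror_point k n w) K
    tau01 alpha0 small erefl erefl e0 rec (fun n => erefl).
  rewrite -/kap -/(zdist w) -/c.
  rewrite mulrA; move/le_trans; apply.
  rewrite lerD2l -[leRHS]mulrA ler_pM2l// ler_pM2l//.
  by apply: ler_sum => n _; apply: ler_wpM2l => //; exact: sqnorm_avg_eps.
have := ge0_expectation_le P _ _ _ pathwise.
have mk2 : measurable_fun setT (fun w => kap * (p / 6) * X2 w)%R.
  exact: measurable_funM.
have mk3 : measurable_fun setT (fun w => kap * 6 * X3 w)%R by exact: measurable_funM.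
have mcz : measurable_fun setT (fun w => c * zdist w)%R by exact: measurable_funM.
have mb := @budget_measurable k.
have mbz : measurable_fun setT (fun w => budget k w + c * zdist w)%R.
  exact: measurable_funD.
move=> /(_ (measurable_funD mX1 mk2) (measurable_funD mbz mk3)
  (fun w => addr_ge0 (X10 w) (mulr_ge0 k6 (X20 w)))).
rewrite (ge0_expectationD P mX1 mk2 X10 (fun w => mulr_ge0 k6 (X20 w))).
rewrite (ge0_expectationD P mbz mk3
  (fun w => addr_ge0 (budget_ge0 k w) (mulr_ge0 c0 (z0 w)))
  (fun w => mulr_ge0 k7 (X30 w))).
rewrite (ge0_expectationD P mb mcz (budget_ge0 k) (fun w => mulr_ge0 c0 (z0 w))).
rewrite (ge0_expectationZ P mX2)// (ge0_expectationZ P mX3)// (ge0_expectationZ P mz)//.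
have -> : \int[P]_w (X2 w)%:E =
    (\sum_(n < K.+1) p * (1 - p) ^+ n * a n.+1)%R%:E.
  rewrite ge0_expectation_sum// -?sumEFin.
  - by apply: eq_bigr => n _; rewrite aE.
  - by move=> n; exact: measurable_displacement.
  - by move=> n w; exact: dotvv_ge0.
have -> : \int[P]_w (X3 w)%:E =
    (\sum_(n < K.+1) p * (1 - p) ^+ n * s n.+1)%R%:E.
  rewrite ge0_expectation_sum// -?sumEFin.
  - by apply: eq_bigr => n _; rewrite sE.
  - by move=> n; exact: measurable_mean_sq_error.
  - by move=> n w; exact: mean_sq_error_ge0.
have -> : \int[P]_w (X1 w)%:E =
    \sum_(n < K.+1) (p * (1 - p) ^+ n)%:E * \int[P]_w (potential k n.+1 w)%:E.
  rewrite ge0_expectation_sum//.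
  - by move=> n; exact: potential_measurable.
  - by move=> n w; exact: potential_ge0.
move=> h; rewrite -(@leeD2rE _ (kap * (p / 6) *
   \sum_(n < K.+1) p * (1 - p) ^+ n * a n.+1)%R%:E)//.
rewrite [(kap * (p / 6) * _)%R%:E]EFinM; apply: le_trans h _.
apply: leeD => //; rewrite -!EFinM lee_fin -[leLHS]mulrA -[leRHS]mulrA ler_pM2l//.
by move: errors; move: (\sum_(n < _) _)%R (\sum_(n < _) _)%R => *; lra.
Qed.

(** The probabilities of positive lengths already add up to [1]. *)
Lemma length_positive k : P (N k @^-1` [set 0%N]) = 0.
Proof.
have [NP _ _] := randomness; have /andP[p0 p1] := p01.
have PN : P (N k @^-1` [set 0%N]) \is a fin_num.
  apply: fin_num_measure; rewrite -[X in measurable X]setTI.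
  exact: measurable_funP.
have P0 : (0 <= fine (P (N k @^-1` [set 0%N])))%R by rewrite fine_ge0.
rewrite -(fineK PN); congr EFin; apply/eqP; rewrite eq_le P0 andbT.
apply: (@le_of_le_geometric _ (1 - p) _ _ 1 0); first by apply/andP; split; lra.
move=> l _; rewrite add0r mul1r.
have m1 (n : nat) : @measurable_fun _ _ (known (seen_seeds k)) R setT (fun=> 1%R).
  exact: measurable_cst.
have := expectation_random_index source_sigma source_measurable source_independent
  (@unseen_length_seeds k) (@subset_refl _ _) m1 (fun n w => ler01).
 have i1 : \int[P]_w (1%R : R)%:E = 1.
  transitivity (1%:E * P setT); first exact: integral_cst.
  by rewrite mul1e; exact: probability_setT.
rewrite i1.
under eq_eseriesr do rewrite mule1.
move=> e1; have := @nneseries_lim_ge R (fun n => P (N k @^-1` [set n])) xpredT 0 l.+1.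
rewrite -e1 => /(_ (fun _ _ _ => measure_ge0 _ _)).
rewrite big_mkord big_ord_recl; under eq_bigr do rewrite NP.
rewrite sumEFin geometric_weights_sum -(fineK PN) -EFinD lee_fin; lra.
Qed.

(** If the right-hand side is finite then so are the second moments of the
    current state, and the truncated bounds apply; otherwise there is nothing to
    prove. *)
Lemma expected_potential_le k :
  \int[P]_w (potential k (N k w) w)%:E <= \int[P]_w (budget k w)%:E.
Proof.
have [NP _ _] := randomness; have /andP[p0 p1] := p01; have /andP[t0 t1] := tau01.
have [->|] := eqVneq (\int[P]_w (budget k w)%:E) +oo; first exact: leey.
rewrite -ltey => fb.
have at0 : (0 < alpha / tau)%R by rewrite divr_gt0.
have fz : distance_sq (fun w => (outer_state k w).2) < +oo.
  apply: (@le_lt_trans _ _ (\int[P]_w (2 * budget k w)%:E)).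
    apply: ge0_expectation_le.
    - exact: measurable_mirror_distance.
    - by apply: measurable_funM => //; exact: budget_measurable.
    - by move=> w; exact: dotvv_ge0.
    move=> w; have A0 : (0 <= (1 - tau) *
        (alpha / tau * (favg f (outer_state k w).1 - favg f xstar)))%R.
      by apply: mulr_ge0; [lra|apply: mulr_ge0; [exact: ltW|rewrite subr_ge0]].
    rewrite /budget; move: A0; move: (_ * (_ * (_ - _)))%R (dotv _ _) => A D; lra.
  rewrite ge0_expectationZ//; last 2 first.
  - exact: budget_measurable.
  - exact: budget_ge0.
  by rewrite lte_mul_pinfty.
have fy : distance_sq (fun w => (outer_state k w).1) < +oo.
  pose r := ((1 - tau) * (alpha / tau) * (mu / 2))%R.
  have r0 : (0 < r)%R by rewrite !mulr_gt0 ?invr_gt0//; lra.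
  apply: (@le_lt_trans _ _ (\int[P]_w (r^-1 * budget k w)%:E)).
    apply: ge0_expectation_le.
    - have [my _] := outer_state_known k.
      exact: (measurable_sqnorm (measurable_vecB (vec_known_measurable my)
        (measurable_vec_cst xstar))).
    - by apply: measurable_funM => //; exact: budget_measurable.
    - by move=> w; exact: dotvv_ge0.
    move=> w; rewrite ler_pdivlMl//.
    have := strongly_convex_growth (outer_state k w).1 (favg_diff f2) fmu fmin.
    have c0 : (0 <= (1 - tau) * (alpha / tau))%R by rewrite mulr_ge0 ?(ltW at0)//; lra.
    move=> /(ler_wpM2l c0); rewrite mulrA -/r => /le_trans; apply.
    by rewrite /budget -[leLHS]mulrA lerDl mulr_ge0 ?invr_ge0 ?dotvv_ge0.
  rewrite ge0_expectationZ ?invr_ge0 ?(ltW r0)//; last 2 first.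
  - exact: budget_measurable.
  - exact: budget_ge0.
  by rewrite lte_mul_pinfty// lee_fin invr_ge0 ltW.
have b0 : 0 <= \int[P]_w (budget k w)%:E.
  by apply: integral_ge0 => w _; rewrite lee_fin budget_ge0.
have d0 : 0 <= distance_sq (fun w => (outer_state k w).2).
  by apply: integral_ge0 => w _; rewrite lee_fin dotvv_ge0.
have pot0 n : 0 <= \int[P]_w (potential k n w)%:E.
  by apply: integral_ge0 => w _; rewrite lee_fin potential_ge0.
have w0 n := geometric_weight_ge0 n p01.
pose T K := \sum_(n < K) (p * (1 - p) ^+ n)%:E * \int[P]_w (potential k n.+1 w)%:E.
have Tle K : T K <= \int[P]_w (budget k w)%:E.
  pose B := fine (\int[P]_w (budget k w)%:E).
  pose D := fine (distance_sq (fun w => (outer_state k w).2)).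
  have Tl l : (K <= l)%N -> T K <= (B + 14 * alpha * tau / theta * D * (1 - p) ^+ l)%:E.
    move=> Kl; apply: (@le_trans _ _ (T l.+1)).
      rewrite /T -!(big_mkord xpredT (fun n => (p * (1 - p) ^+ n)%:E *
        \int[P]_w (potential k n.+1 w)%:E)).
      by apply: lee_sum_nneg_natr (leqW Kl) => n _ _; rewrite mule_ge0// lee_fin.
    apply: le_trans (truncated_epoch_bound l fy fz) _.
    have -> : (B + 14 * alpha * tau / theta * D * (1 - p) ^+ l)%:E =
        B%:E + (14 * alpha * tau / theta * (1 - p) ^+ l)%:E * D%:E.
      by rewrite -EFinM -EFinD mulrAC.
    by rewrite !fineK// ge0_fin_numE.
  have TK0 : 0 <= T K by apply: sume_ge0 => n _; rewrite mule_ge0// lee_fin.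
  have TKfin : T K \is a fin_num.
    by rewrite ge0_fin_numE//; apply: le_lt_trans (Tl K (leqnn K)) _; rewrite ltry.
  have -> : \int[P]_w (budget k w)%:E = B%:E by rewrite fineK// ge0_fin_numE.
  rewrite -(fineK TKfin) lee_fin.
  apply: (@le_of_le_geometric _ (1 - p) _ _ (14 * alpha * tau / theta * D) K).
    by apply/andP; split; lra.
  by move=> l Kl; rewrite -lee_fin fineK//; exact: Tl.
rewrite (expectation_random_index source_sigma source_measurable source_independent
  (@unseen_length_seeds k) (@subset_refl _ _) (@potential_known k) (potential_ge0 k)).
apply: lime_le.
  by apply: is_cvg_nneseries => n _ _; rewrite mule_ge0.
apply: nearW => -[|K]; first by rewrite big_mkord big_ord0.
rewrite big_mkord big_ord_recl length_positive mul0e add0e.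
by under eq_bigr do rewrite NP; exact: Tle.
Qed.

Lemma expected_descent k :
  'E_P[(fun w => alpha / tau * (favg f (outer_state k.+1 w).1 - favg f xstar)
         + (1 + mu * alpha) / 2 * enorm ((outer_state k.+1 w).2 - xstar) ^+ 2)%R]
  <= 'E_P[(fun w => (1 - tau) * (alpha / tau * (favg f (outer_state k w).1 - favg f xstar))
         + (1 + mu * alpha)^-1 *
           ((1 + mu * alpha) / 2 * enorm ((outer_state k w).2 - xstar) ^+ 2))%R].
Proof.
rewrite unlock; apply: (@le_trans _ _ (\int[P]_w (potential k (N k w) w)%:E)).
  rewrite le_eqVlt; apply/orP; left; apply/eqP.
  by apply: eq_integral => w _; rewrite /potential enorm_sqr outer_stateS.
apply: le_trans (expected_potential_le k) _.
rewrite le_eqVlt; apply/orP; left; apply/eqP.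
apply: eq_integral => w _; rewrite /budget enorm_sqr; congr (_ + _)%:E.
have m0 : (0 < 1 + mu * alpha)%R by rewrite addr_gt0 ?mulr_gt0.
rewrite [(_^-1 * _)%R in RHS]mulrA; congr (_ * _)%R.
by rewrite mulrA mulVf ?mul1r// gt_eqF.
Qed.

End RandomEpochs.

Theorem theorem2 (R : realType) (d M : nat) (M_gt0 : (0 < M)%N)
    (f : 'I_M -> 'rV[R]_d -> R) (delta mu : R) (xstar : 'rV[R]_d)
    (dS : measure_display) (S : measurableType dS) (Q : probability S R)
    (C : S -> 'rV[R]_d -> 'rV[R]_d) (beta : R)
    (dO : measure_display) (Omega : measurableType dO) (P : probability Omega R)
    (N : nat -> {RV P >-> nat}) (xi : nat -> nat -> 'I_M -> {RV P >-> S})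
    (p theta tau alpha : R) (y0 : 'rV[R]_d) :
  (forall m, twice_differentiable (f m)) ->
  0 < delta -> delta_related delta f ->
  0 < mu -> strongly_convex mu (favg f) ->
  is_minimizer (favg f) xstar ->
  1 < beta -> biased_compressor Q beta C ->
  0 < p < 1 -> 0 < theta -> 0 < tau < 1 -> 0 < alpha ->
  olga_randomness Q p N xi ->
  theta <= p `^ (3 / 2) / (24 * delta) ->
  p `^ (3 / 2) / (24 * delta) <= 1 / (6 * delta) ->
  28 * alpha * p * tau <= theta ->
  let yz k (w : Omega) :=
    ef_olga f (Ordinal M_gt0) C p theta mu tau alpha y0
      (fun k => N k w) (fun k j m => xi k j m w) k in
  let Y k w := alpha / tau * (favg f (yz k w).1 - favg f xstar) in
  let Z k w := (1 + mu * alpha) / 2 * enorm ((yz k w).2 - xstar) ^+ 2 in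
  forall k : nat,
    ('E_P[(fun w => Y k.+1 w + Z k.+1 w)%R]
     <= 'E_P[(fun w => (1 - tau) * Y k w + (1 + mu * alpha)^-1 * Z k w)%R])%E.
Proof.
move=> f2 delta0 fdelta mu0 fmu fmin beta1 compressor p01 theta0 tau01 alpha0.
move=> randomness theta_le _ small yz Y Z k.
exact: (expected_descent M_gt0 y0 f2 delta0 fdelta mu0 fmu fmin p01 theta0 theta_le
  tau01 alpha0 small beta1 compressor randomness k).
Qed.
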